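(* Let $Z$ be an offspring distribution with $1<\mathbb{E}(Z)<\infty$ and $\mathbb{P}(Z=0)=0$. On an almost sure sample of the Galton–Watson tree $(T_{\mathrm{GW}},\rho)$ with offspring distribution $Z$, or of the unimodular Galton–Watson tree $(T_{\mathrm{UGW}},\rho)$, the loop contracting random walk (LCRW) is transient from every vertex almost surely.
   Context: $(T_{\mathrm{GW}},\rho)$ is the Galton–Watson tree rooted at its ancestor with offspring law $Z$. The augmented Galton–Watson tree $(T_{\mathrm{AGW}},\rho)$ is obtained by letting the root have $Z+1$ children (instead of $Z$), each of which independently generates a Galton–Watson tree with offspring law $Z$ (equivalently, join the roots of two independent copies of $T_{\mathrm{GW}}$ by an edge and root at one endpoint); $(T_{\mathrm{UGW}},\rho)$ is the law of $T_{\mathrm{AGW}}$ biased by $1/\deg(\rho)$ (normalized). Contraction of an oriented cycle $C$ in a multigraph: remove the vertices of $C$ and all oriented edges with both endpoints in $C$, add a new vertex $v_C$, and replace each oriented edge with exactly one endpoint in $C$ by the edge with that endpoint replaced by $v_C$. LCRW on an infinite graph $G$ started at $x$: a random sequence $(G_i,P_i,X_i)_{i\ge0}$ with $G_0=G$, $P_0$ the empty path at $x$, $X_0=x$; at each step choose uniformly at random (with multiplicity, independently) an outgoing oriented edge $\vec e$ of $X_i$ in $G_i$. If the head of $\vec e$ is a vertex $y$ on the simple path $P_i$, contract the cycle formed by the part of $P_i$ from $y$ to $X_i$ and $\vec e$ to get $G_{i+1}$, truncate $P_i$ at $y$ to get $P_{i+1}$ (now ending at the new vertex $v_C$), and set $X_{i+1}=v_C$;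 otherwise $G_{i+1}=G_i$, $P_{i+1}=P_i$ extended by $\vec e$, $X_{i+1}$ the head of $\vec e$. The LCRW is transient from $x$ if a.s. $P_i$ converges to an infinite path (every initial segment is eventually constant and the length tends to infinity). *)

(* Defs.v *)
From HB Require Import structures.
From mathcomp Require Import all_boot all_order all_algebra.
From mathcomp Require Import all_classical all_reals all_analysis.
Set Implicit Arguments. Unset Strict Implicit. Unset Printing Implicit Defensive.
Import Order.TTheory GRing.Theory Num.Theory.
Local Open Scope classical_set_scope.
Local Open Scope ring_scope.

Definition offspring_law (R : realType) (p : nat -> R) : Prop :=
  (forall k, 0 <= p k) /\ (\sum_(k <oo) (p k)%:E = 1)%E.

Definition mean (R : realType) (p : nat -> R) : \bar R :=
  (\sum_(k <oo) (k%:R * p k)%:E)%E.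

Definition shift_law (R : realType) (p : nat -> R) (k : nat) : R :=
  if k is k'.+1 then p k' else 0.

Definition mutual_indep (R : realType) d (Omega : measurableType d)
  (P : probability Omega R) (I : eqType) (X : I -> Omega -> nat) : Prop :=
  forall (s : seq I) (B : I -> set nat), uniq s ->
    P (\big[setI/setT]_(i <- s) (X i @^-1` B i)) =
    (\prod_(i <- s) P (X i @^-1` B i))%E.

Definition indep_family_with_laws (R : realType) d (Omega : measurableType d)
  (P : probability Omega R) (I : eqType) (law : I -> nat -> R)
  (X : I -> Omega -> nat) : Prop :=
  [/\ forall i, measurable_fun setT (X i),
      forall i k, P (X i @^-1` [set k]) = (law i k)%:E
    & mutual_indep P X].

(* A vertex is a word u = [:: i1; ...; ik]; the root rho is [::].
   Given offspring numbers f : seq nat -> nat, u is a vertex of the tree iff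
   each letter is smaller than the offspring number of the corresponding prefix. *)
Definition vertex := seq nat.

Definition inT (f : vertex -> nat) (u : vertex) : bool :=
  all (fun j => (nth 0%N u j < f (take j u))%N) (iota 0 (size u)).

Definition nbrs (f : vertex -> nat) (u : vertex) : seq vertex :=
  [seq rcons u i | i <- iota 0 (f u)] ++
  (if u is [::] then [::] else [:: take (size u).-1 u]).

Definition GW_family (R : realType) d (Omega : measurableType d)
  (P : probability Omega R) (p : nat -> R) (xi : vertex -> Omega -> nat) :=
  indep_family_with_laws P (fun _ : vertex => p) xi.

Definition AGW_family (R : realType) d (Omega : measurableType d)
  (P : probability Omega R) (p : nat -> R) (xi : vertex -> Omega -> nat) :=
  indep_family_with_laws P
    (fun u : vertex => if u is [::] then shift_law p else p) xi.

(* Q is the law P biased by 1/deg(rho) (normalized); deg(rho) = xi [::]. *)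
Definition UGW_bias (R : realType) d (Omega : measurableType d)
  (P Q : probability Omega R) (xi : vertex -> Omega -> nat) : Prop :=
  forall A, measurable A ->
    (Q A * \int[P]_w ((xi [::] w)%:R^-1)%:E
     = \int[P]_(w in A) ((xi [::] w)%:R^-1)%:E)%E.

(* The multigraph G_i is encoded by the partition of the tree's vertices into
   blocks: a vertex of G_i is a block (the set of original vertices contracted
   into it, blk v being the block containing v), and the oriented edges of G_i
   are the oriented tree edges (u,w) with u, w in different blocks, with tail
   blk u and head blk w.  Contracting a cycle replaces its blocks by their union.
   The path P_i is the sequence of its oriented edges. *)
Definition edge := (vertex * vertex)%type.
Definition lcrw_state := ((vertex -> seq vertex) * seq edge)%type.

Definition lcrw_init : lcrw_state := (fun v => [:: v], [::]).

Definition out_edges (f : vertex -> nat) (X : seq vertex) : seq edge :=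
  [seq (u, w) | u <- X, w <- [seq w <- nbrs f u | w \notin X]].

(* one step; ch n is a choice index in {0,...,n} used to pick uniformly
   among the n+1 outgoing edges *)
Definition lcrw_step (f : vertex -> nat) (x : vertex) (ch : nat -> nat)
  (s : lcrw_state) : lcrw_state :=
  let: (blk, P) := s in
  let pv := [seq blk v | v <- x :: [seq e.2 | e <- P]] in
  let X := last (blk x) pv in
  let O := out_edges f X in
  if O is [::] then s else
  let e := nth (x, x) O (ch (size O).-1) in
  let j := find (fun B => e.2 \in B) pv in
  if (j < size pv)%N then
    let U := flatten (drop j pv) in
    ((fun v => if v \in U then U else blk v), take j P)
  else (blk, rcons P e).

Fixpoint lcrw (f : vertex -> nat) (x : vertex) (c : nat -> nat -> nat)
  (i : nat) : lcrw_state :=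
  if i is i'.+1 then lcrw_step f x (c i') (lcrw f x c i') else lcrw_init.

Definition converges_to_infinite_path (P : nat -> seq edge) : Prop :=
  forall k, exists N, forall i, (N <= i)%N ->
    (k <= size (P i))%N /\ take k (P i) = take k (P N).

Definition choice_family (R : realType) d (Omega : measurableType d)
  (Q : probability Omega R) (c : nat -> nat -> Omega -> nat) : Prop :=
  [/\ forall i n, measurable_fun setT (c i n),
      forall i n k, (k <= n)%N -> Q (c i n @^-1` [set k]) = (n.+1%:R^-1)%:E
    & mutual_indep Q (fun ij : nat * nat => c ij.1 ij.2)].

Definition LCRW_transient (R : realType) (f : vertex -> nat) (x : vertex) : Prop :=
  forall d (Omega : measurableType d) (Q : probability Omega R)
    (c : nat -> nat -> Omega -> nat),
    choice_family Q c ->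
    {ae Q, forall w, converges_to_infinite_path
                       (fun i => (lcrw f x (fun i n => c i n w) i).2)}.

(* Main.v *)
Require Import Defs.
From HB Require Import structures.
From mathcomp Require Import all_boot all_order all_algebra.
From mathcomp Require Import all_classical all_reals all_analysis.
From mathcomp Require Import measurable_realfun.
From mathcomp Require Import zify ring lra.
Set Implicit Arguments. Unset Strict Implicit. Unset Printing Implicit Defensive.
Import Order.TTheory GRing.Theory Num.Theory.

(** Contracted blocks of a tree are connected, so the path of blocks
    [B_0, ..., B_L] is traversed like a stack: from the top block there is at most
    one oriented edge leading back (which merges the two top blocks), and every
    other edge leads to an unexplored vertex (which is pushed as a new block).
    Under the annealed law the offspring number of a pushed vertex is fresh with
    law [p], except for the finitely many prefixes of the starting vertex [x].
    Let [a] be the number of unexplored edges at the top block.  The function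
    [lam ^ L * psi], with [psi = c] if [a >= 2] and [psi = 1] if [a = 1] (for [c]
    and [lam] slightly less than 1), is contracted in mean by a factor [rho < 1]
    at each step: when [a = 1] the walk is nearly balanced, but a push creates a
    block with [a >= 2] with probability [1 - p 1 > 0]; when [a >= 2] there is a
    genuine drift away from [x], and a merge preserves [a >= 2].
    Hence the annealed probability that [L <= n] at time [t] decays
    exponentially in [t], so almost every tree has summable quenched
    probabilities, and Borel-Cantelli gives [L -> oo]. *)

(** * Geometry of the walk *)

(* The neighbour of [v] on the geodesic to [x]; [toward x x = x]. *)
Definition toward (x v : vertex) : vertex :=
  if prefix v x then take (size v).+1 x else take (size v).-1 v.

Lemma toward_root x : toward x x = x.
Proof. by rewrite /toward prefix_refl take_oversize. Qed.

(** An edge joins a word to the word without its last letter. If the longer word is a prefix of [x],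
    the shorter end points to it; otherwise the longer end points to the shorter one. *)
Lemma nbrs_toward x f u w : w \in nbrs f u -> toward x w = u \/ toward x u = w.
Proof.
rewrite /nbrs mem_cat => /orP[/mapP[i _ ->]|].
  rewrite {1}/toward; case: ifPn => pw.
    right; have pu : prefix u x by apply: prefix_trans pw; exact: prefix_rcons.
    by rewrite /toward pu; move: pw; rewrite prefixE size_rcons => /eqP.
  by left; rewrite size_rcons /= -cats1 take_size_cat.
case: u => [//|a u]; rewrite inE => /eqP ->; rewrite {2}/toward.
case: ifPn => pu; last by right.
left; have pw : prefix (take (size (a :: u)).-1 (a :: u)) x.
  by apply: prefix_trans pu; exact: prefix_take.
rewrite /toward pw size_takel ?leq_pred//=.
by move: pu; rewrite prefixE => /eqP.
Qed.

Lemma nbrs_neq f u w : w \in nbrs f u -> w != u.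
Proof.
rewrite /nbrs mem_cat => /orP[/mapP[i _ ->]|].
  by apply/eqP => /(congr1 size); rewrite size_rcons => /eqP; rewrite eqn_leq ltnn.
case: u => [//|a u]; rewrite inE => /eqP ->.
apply/eqP => /(congr1 size); rewrite size_takel ?leq_pred//= => /eqP.
by rewrite eqn_leq ltnn andbF.
Qed.

Lemma uniq_nbrs f u : uniq (nbrs f u).
Proof.
rewrite /nbrs cat_uniq map_inj_uniq ?iota_uniq/=; last exact: rcons_injr.
case: u => [//|a u]; rewrite has_seq1 andbT.
apply/negP => /mapP[i _ /(congr1 size)].
rewrite size_rcons size_takel ?leq_pred//= => /eqP.
by rewrite eqn_leq (leqNgt (size u).+2) ltnS leqnSn andbF.
Qed.

Lemma mem_out_edges f X u w : ((u, w) \in out_edges f X) =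
  [&& u \in X, w \in nbrs f u & w \notin X].
Proof.
apply/allpairsPdep/and3P => [[a [b [aX]]]|[uX wn wX]].
  by rewrite mem_filter => /andP[bX ba] [-> ->].
by exists u, w; rewrite mem_filter wX.
Qed.

Lemma uniq_out_edges f X : uniq X -> uniq (out_edges f X).
Proof.
move=> uX; apply: allpairs_uniq_dep => //.
  by move=> u _; exact/filter_uniq/uniq_nbrs.
by move=> [a b] [a' b'] _ _ /= [-> ->].
Qed.

Lemma eq_out_edges f g X : {in X, f =1 g} -> out_edges f X = out_edges g X.
Proof.
move=> fg; rewrite /out_edges; congr flatten; apply/eq_in_map => u uX.
by rewrite /nbrs fg.
Qed.

(** * The walk as a stack of blocks *)

Definition reps x (P : seq edge) : seq vertex := x :: [seq e.2 | e <- P].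

Definition blocks x (s : lcrw_state) : seq (seq vertex) :=
  [seq s.1 v | v <- reps x s.2].

Definition top_block x (s : lcrw_state) : seq vertex :=
  last (s.1 x) (blocks x s).

Definition visited x (s : lcrw_state) : seq vertex := flatten (blocks x s).

Definition step_along x (e : edge) (s : lcrw_state) : lcrw_state :=
  let pv := blocks x s in
  let j := find (fun B => e.2 \in B) pv in
  if (j < size pv)%N then
    let U := flatten (drop j pv) in
    ((fun v => if v \in U then U else s.1 v), take j s.2)
  else (s.1, rcons s.2 e).

(** The random step is split into an index [k] and a deterministic update, so that step
    probabilities become averages over [k]. The default [(x, x)] is read only when [k] is out of
    range. *)
Definition step_among x (O : seq edge) (k : nat) (s : lcrw_state) : lcrw_state :=
  if O is [::] then s else step_along x (nth (x, x) O k) s.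

Lemma lcrw_stepE f x ch s : lcrw_step f x ch s =
  let O := out_edges f (top_block x s) in step_among x O (ch (size O).-1) s.
Proof. by case: s. Qed.

(* Each block is represented by the vertex through which it was entered, [x]
   for [B_0]; [inv_toward] and [inv_path] say that the blocks are connected and
   strung along the path. *)
Record walk_inv x (s : lcrw_state) : Prop := WalkInv {
  inv_uniq : uniq (visited x s);
  inv_mem : forall r, r \in reps x s.2 -> r \in s.1 r;
  inv_blk : forall r v, r \in reps x s.2 -> v \in s.1 r -> s.1 v = s.1 r;
  inv_toward : forall r v, r \in reps x s.2 -> v \in s.1 r ->
    v = r \/ toward x v \in s.1 r;
  inv_path : path (fun r r' => toward x r' \in s.1 r) x [seq e.2 | e <- s.2];
  inv_out : forall v, v \notin visited x s -> s.1 v = [:: v] }.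

Lemma walk_inv_init x : walk_inv x lcrw_init.
Proof.
split => //=.
- by move=> r _; rewrite inE.
- by move=> r v _; rewrite inE => /eqP ->.
- by move=> r v _; rewrite inE => /eqP ->; left.
Qed.

(** A duplicate-free concatenation makes the blocks disjoint, and each block is nonempty since it
    contains its representative. *)
Lemma flatten_rep_inj (F : vertex -> seq vertex) rs :
  uniq (flatten (map F rs)) -> (forall r, r \in rs -> r \in F r) ->
  uniq rs /\ {in rs &, forall r r', r' \in F r -> r' = r}.
Proof.
elim: rs => //= a rs IH; rewrite cat_uniq => /and3P[_ /hasPn dis uf] Fm.
have [|urs inj] := IH uf; first by move=> r rrs; apply: Fm; rewrite inE rrs orbT.
have Frs r v : r \in rs -> v \in F r -> v \notin F a.
  move=> rrs vF; apply: dis; apply/flattenP; exists (F r) => //.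
  exact: map_f.
have mrs r : r \in rs -> r \in F r.
  by move=> rrs; apply: Fm; rewrite inE rrs orbT.
split.
  rewrite urs andbT; apply/negP => ars.
  by move: (Frs _ _ ars (mrs _ ars)); rewrite mrs.
move=> r r'; rewrite !inE => /orP[/eqP->|rrs] /orP[/eqP->|r'rs] //.
- by move=> h; move: (Frs _ _ r'rs (mrs _ r'rs)); rewrite h.
- by move=> h; move: (Frs _ _ rrs h); rewrite Fm ?inE ?eqxx.
- exact: inj.
Qed.

Definition top_rep x (s : lcrw_state) : vertex := last x [seq e.2 | e <- s.2].

Lemma top_blockE x s : top_block x s = s.1 (top_rep x s).
Proof. by rewrite /top_block /blocks /reps /= last_map. Qed.

Lemma top_rep_in x s : top_rep x s \in reps x s.2.
Proof. exact: mem_last. Qed.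

Lemma visitedP x s v :
  reflect (exists2 r, r \in reps x s.2 & v \in s.1 r) (v \in visited x s).
Proof.
apply: (iffP flattenP) => [[B /mapP[r rr ->] vB]|[r rr vr]]; first by exists r.
by exists (s.1 r) => //; exact: map_f.
Qed.

Section walk_inv_theory.
Variables (x : vertex) (s : lcrw_state).
Hypothesis inv : walk_inv x s.
Let X := top_block x s.

Lemma top_rep_mem : top_rep x s \in X.
Proof. by rewrite /X top_blockE; apply: (inv_mem inv); exact: top_rep_in. Qed.

Lemma top_sub_visited v : v \in X -> v \in visited x s.
Proof.
move=> vX; apply/visitedP; exists (top_rep x s); first exact: top_rep_in.
by rewrite -top_blockE.
Qed.

Lemma uniq_reps : uniq (reps x s.2).
Proof. by have [] := flatten_rep_inj (inv_uniq inv) (inv_mem inv). Qed.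

Lemma rep_unique r r' : r \in reps x s.2 -> r' \in reps x s.2 ->
  r' \in s.1 r -> r' = r.
Proof.
by have [_ h] := flatten_rep_inj (inv_uniq inv) (inv_mem inv); exact: h.
Qed.

Lemma rep_in_top r v : r \in reps x s.2 -> v \in s.1 r -> v \in X ->
  r = top_rep x s.
Proof.
rewrite /X top_blockE => rr vr vX; apply: rep_unique => //; first exact: top_rep_in.
rewrite -(inv_blk inv (top_rep_in x s) vX) (inv_blk inv rr vr).
exact: (inv_mem inv).
Qed.

(** That neighbour lies in the block just below that of [r]. Were it in the top block, the top
    representative would occur both before [r] and at or after [r] in a duplicate-free list. *)
Lemma toward_rep_notin_top r : r \in [seq e.2 | e <- s.2] -> toward x r \notin X.
Proof.
move=> rp; apply/negP => tX; have := inv_path inv; have := uniq_reps.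
have [p1 [p2 ep]] : exists p1 p2, [seq e.2 | e <- s.2] = p1 ++ r :: p2.
  by case/splitPr: rp => p1 p2; exists p1, p2.
rewrite /reps ep cat_path => + /and3P[_ h _].
have r0 : last x p1 = top_rep x s.
  apply: rep_in_top tX => //; rewrite /reps ep.
  have := mem_last x p1; rewrite !inE mem_cat => /orP[->//|->].
  by rewrite orbT.
rewrite -cat_cons cat_uniq => /and3P[_ /hasPn /(_ (top_rep x s)) + _].
rewrite -{2}r0 mem_last => /(_ _)/negP []//.
by rewrite /top_rep ep last_cat /= mem_last.
Qed.

(** Absence of cycles: the only possible return edge leaves from the entry vertex of the top block.
    If [w] pointed to [u] instead, either [w] would be a representative, excluded by
    [toward_rep_notin_top] and [toward_root], or [w] would share the block of [u]. *)
Lemma out_edge_visited f u w : u \in X -> w \in nbrs f u -> w \notin X ->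
  w \in visited x s ->
  [/\ u = top_rep x s, w = toward x u & s.2 != [::]].
Proof.
move=> uX wu wX /visitedP[r rr wr].
have [twu|tuw] := nbrs_toward x wu.
  exfalso; case: (inv_toward inv rr wr) => [wr'|twr].
    move: rr; rewrite /reps inE -wr' => /orP[/eqP wx|].
      by move: (nbrs_neq wu); rewrite wx -twu wx toward_root eqxx.
    by move=> /toward_rep_notin_top; rewrite twu uX.
  rewrite twu in twr; have rt := rep_in_top rr twr uX.
  by move: wX; rewrite /X top_blockE -rt wr.
have ut : u = top_rep x s.
  have := uX; rewrite /X top_blockE => uX'.
  case: (inv_toward inv (top_rep_in x s) uX') => // tX.
  by move: wX; rewrite -tuw /X top_blockE tX.
split=> //; apply/eqP => s0; move: (nbrs_neq wu).
by rewrite -tuw ut /top_rep s0 /= toward_root eqxx.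
Qed.

(** The visited set is closed under [toward x]: within a block by [inv_toward], across blocks by
    [inv_path]. So an unexplored neighbour lies on the far side from [x]. *)
Lemma out_edge_fresh f u w : u \in X -> w \in nbrs f u ->
  w \notin visited x s -> toward x w = u.
Proof.
move=> uX wu wv; have [//|tuw] := nbrs_toward x wu.
exfalso; have := uX; rewrite /X top_blockE => uX'.
case: (inv_toward inv (top_rep_in x s) uX') => [ut|tX]; last first.
  by move: wv; rewrite -tuw top_sub_visited// /X top_blockE.
have := top_rep_in x s; rewrite -ut inE => /orP[/eqP ux|ur].
  by move: (nbrs_neq wu); rewrite -tuw ux toward_root eqxx.
suff : toward x u \in visited x s by rewrite tuw (negbTE wv).
have [p1 [p2 ep]] : exists p1 p2, [seq e.2 | e <- s.2] = p1 ++ u :: p2.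
  by case/splitPr: ur => p1 p2; exists p1, p2.
have := inv_path inv; rewrite ep cat_path => /and3P[_ h _]; apply/visitedP; exists (last x p1) => //.
rewrite /reps ep; have := mem_last x p1; rewrite !inE mem_cat => /orP[->//|->].
by rewrite orbT.
Qed.

End walk_inv_theory.

Lemma rep_eq x s (inv : walk_inv x s) r r' v :
  r \in reps x s.2 -> r' \in reps x s.2 -> v \in s.1 r -> v \in s.1 r' -> r = r'.
Proof.
move=> rr rr' vr vr'; apply: (rep_unique inv) => //.
by rewrite -(inv_blk inv rr' vr') (inv_blk inv rr vr); exact: (inv_mem inv).
Qed.

Lemma reps_rcons x P e : reps x (rcons P e) = rcons (reps x P) e.2.
Proof. by rewrite /reps map_rcons rcons_cons. Qed.

(** * Pushing an unexplored vertex *)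

Section step_fresh.
Variables (x : vertex) (s : lcrw_state) (f : vertex -> nat) (e : edge).
Hypothesis inv : walk_inv x s.
Hypothesis eO : e \in out_edges f (top_block x s).
Hypothesis fresh : e.2 \notin visited x s.
Let s' := (s.1, rcons s.2 e).

Lemma step_along_fresh : step_along x e s = s'.
Proof.
rewrite /step_along -has_find; case: hasP => // -[B Bb eB].
by move: fresh; have -> : e.2 \in visited x s by apply/flattenP; exists B.
Qed.

Lemma blk_fresh : s.1 e.2 = [:: e.2].
Proof. exact: (inv_out inv). Qed.

Lemma visited_fresh : visited x s' = rcons (visited x s) e.2.
Proof.
rewrite /visited /blocks /s' reps_rcons map_rcons flatten_rcons.
by rewrite -[RHS]cats1; congr (_ ++ _); exact: blk_fresh.
Qed.

Lemma top_block_fresh : top_block x s' = [:: e.2].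
Proof. by rewrite top_blockE /s' /top_rep /= map_rcons last_rcons blk_fresh. Qed.

Lemma walk_inv_fresh : walk_inv x s'.
Proof.
have := eO; case E : e => [u w] /=; rewrite mem_out_edges => /and3P[uX wu wX].
have we : w = e.2 by rewrite E.
have tw : toward x w = u by apply: (out_edge_fresh inv uX wu); rewrite we.
split; rewrite ?visited_fresh.
- by rewrite rcons_uniq fresh; exact: (inv_uniq inv).
- move=> r; rewrite /= reps_rcons mem_rcons inE => /orP[/eqP->|]; last exact: (inv_mem inv).
  by rewrite blk_fresh inE.
- move=> r v; rewrite /= reps_rcons mem_rcons inE => /orP[/eqP->|rr]; last exact: (inv_blk inv).
  by rewrite blk_fresh inE => /eqP->; rewrite blk_fresh.
- move=> r v; rewrite /= reps_rcons mem_rcons inE => /orP[/eqP->|rr]; last exact: (inv_toward inv).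
  by rewrite blk_fresh inE => /eqP ->; left.
- rewrite /= map_rcons rcons_path (inv_path inv) /=.
  by move: uX; rewrite top_blockE -we tw.
- move=> v; rewrite mem_rcons inE negb_or => /andP[_]; exact: (inv_out inv).
Qed.

End step_fresh.

(** * Merging the two top blocks *)

Section step_back.
Variables (x : vertex) (s : lcrw_state) (f : vertex -> nat) (e e0 : edge).
Variable P : seq edge.
Hypothesis inv : walk_inv x s.
Hypothesis eO : e \in out_edges f (top_block x s).
Hypothesis back : e.2 \in visited x s.
Hypothesis sP : s.2 = rcons P e0.
Let q := [seq e.2 | e <- P].
Let U := s.1 (last x q) ++ top_block x s.
Let s' : lcrw_state := (fun v => if v \in U then U else s.1 v, P).

Lemma top_rep_rcons : top_rep x s = e0.2.
Proof. by rewrite /top_rep sP map_rcons last_rcons. Qed.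

Lemma blocks_rcons : blocks x s =
  [seq s.1 v | v <- belast x q] ++ [:: s.1 (last x q); top_block x s].
Proof.
rewrite /blocks sP reps_rcons /reps -/q lastI 2!map_rcons -!cats1 -catA.
by rewrite top_blockE top_rep_rcons.
Qed.

Lemma reps_rcons_perm : reps x s.2 = belast x q ++ [:: last x q; e0.2].
Proof. by rewrite sP reps_rcons /reps -/q lastI -!cats1 -catA. Qed.

Lemma toward_top_rep : toward x e0.2 \in s.1 (last x q).
Proof. by have := inv_path inv; rewrite sP map_rcons rcons_path => /andP[]. Qed.

Lemma belast_notin_U r v : r \in belast x q -> v \in s.1 r -> v \notin U.
Proof.
move=> rb vr; have ur := uniq_reps inv; rewrite reps_rcons_perm in ur.
have rr : r \in reps x s.2 by rewrite reps_rcons_perm mem_cat rb.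
have [h1 h2] : r != last x q /\ r != e0.2.
  move: ur; rewrite cat_uniq => /and3P[_ /hasPn h _].
  split; apply/eqP => re; move: rb; rewrite re; apply/negP; apply: h.
  + by rewrite inE eqxx.
  + by rewrite !inE eqxx orbT.
rewrite /U mem_cat negb_or; apply/andP; split; apply/negP => vl.
  move: h1; rewrite (rep_eq inv rr _ vr vl) ?eqxx//.
  by rewrite reps_rcons_perm mem_cat !inE eqxx orbT.
by move: h2; rewrite -top_rep_rcons (rep_in_top inv rr vr vl) eqxx.
Qed.

(** The return edge ends in the block just below the top, so the search stops at index [size P] and
    the contracted cycle consists of exactly two blocks. *)
Lemma step_along_back : step_along x e s = s'.
Proof.
have := eO; case E : e => [u w]; rewrite mem_out_edges => /and3P[uX wu wX].
have [ut wt _] : [/\ u = top_rep x s, w = toward x u & s.2 != [::]].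
  by apply: (out_edge_visited inv uX wu wX); move: back; rewrite E.
have wl : w \in s.1 (last x q) by rewrite wt ut top_rep_rcons toward_top_rep.
have hb : has (fun B => w \in B) [seq s.1 v | v <- belast x q] = false.
  apply/negbTE/hasPn => B /mapP[r rb ->]; apply/negP => wr.
  by move: (belast_notin_U rb wr); rewrite /U mem_cat wl.
have fj : find (fun B => w \in B) (blocks x s) = size P.
  by rewrite blocks_rcons find_cat hb /= wl size_map size_belast size_map addn0.
rewrite /step_along [(u, w).2]/= fj ifT; last first.
  by rewrite /blocks sP size_map /reps /= size_map size_rcons ltnS leqW.
rewrite blocks_rcons drop_size_cat ?size_map ?size_belast ?size_map//=.
by rewrite cats0 /s' sP -cats1 take_size_cat.
Qed.

Lemma blk_belast r : r \in belast x q -> s'.1 r = s.1 r.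
Proof.
move=> rb; rewrite /= (negbTE (belast_notin_U rb _))//.
by apply: (inv_mem inv); rewrite reps_rcons_perm mem_cat rb.
Qed.

Lemma last_in_U : last x q \in U.
Proof.
rewrite mem_cat (inv_mem inv)// reps_rcons_perm mem_cat inE eqxx.
by rewrite orbT.
Qed.

Lemma blocks_back : blocks x s' = [seq s.1 v | v <- belast x q] ++ [:: U].
Proof.
rewrite /blocks {2}/s' /= /reps -/q -map_cons lastI map_rcons -cats1.
congr (_ ++ _); last by rewrite last_in_U.
by apply/eq_in_map => r; exact: blk_belast.
Qed.

Lemma visited_back : visited x s' = visited x s.
Proof. by rewrite /visited blocks_back blocks_rcons !flatten_cat /= !cats0. Qed.

Lemma top_block_back : top_block x s' = U.
Proof. by rewrite /top_block blocks_back last_cat. Qed.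

Lemma reps_back r : r \in reps x P -> r \in belast x q \/ r = last x q.
Proof.
by rewrite /reps -/q lastI mem_rcons inE => /orP[/eqP|]; [right|left].
Qed.

Lemma reps_back_sub r : r \in reps x P -> r \in reps x s.2.
Proof. by rewrite sP reps_rcons mem_rcons inE => ->; rewrite orbT. Qed.

Lemma walk_inv_back : walk_inv x s'.
Proof.
split; rewrite ?visited_back.
- exact: (inv_uniq inv).
- move=> r /= rr; case: ifPn => // _; apply: (inv_mem inv); exact: reps_back_sub.
- move=> r v /= rr; case/reps_back : (rr) => [rb|->].
    rewrite (negbTE (belast_notin_U rb _)); last exact/(inv_mem inv)/reps_back_sub.
    move=> vr; rewrite (negbTE (belast_notin_U rb vr)).
    exact: (inv_blk inv (reps_back_sub rr) vr).
  by rewrite last_in_U => ->.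
- move=> r v /= rr; case/reps_back : (rr) => [rb|->].
    rewrite (negbTE (belast_notin_U rb _)); last exact/(inv_mem inv)/reps_back_sub.
    by move=> vr; exact: (inv_toward inv (reps_back_sub rr) vr).
  have lr : last x q \in reps x s.2 by rewrite reps_rcons_perm mem_cat inE eqxx orbT.
  rewrite last_in_U {1}/U mem_cat => /orP[vl|vt].
    case: (inv_toward inv lr vl) => [->|h]; first by left.
    by right; rewrite mem_cat h.
  right; move: vt; rewrite mem_cat top_blockE => vt.
  case: (inv_toward inv (top_rep_in x s) vt) => [->|->]; last by rewrite orbT.
  by rewrite top_rep_rcons toward_top_rep.
- have := inv_path inv; rewrite sP map_rcons rcons_path => /andP[+ _].
  apply: (@sub_in_path _ (mem (reps x P))); last by apply/allP => r.
  move=> r r' rr _ /= h; case/reps_back : rr => [rb|rl].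
    rewrite (negbTE (belast_notin_U rb _))//; apply/(inv_mem inv).
    by rewrite reps_rcons_perm mem_cat rb.
  by rewrite rl last_in_U mem_cat -rl h.
- move=> v vv /=; rewrite ifF; first exact: (inv_out inv).
  apply/negbTE; apply: contra vv => vU; rewrite -visited_back -top_block_back in vU *.
  exact: top_sub_visited.
Qed.

End step_back.

(** * Degrees and the Lyapunov function *)

Definition fresh_degree x (f : vertex -> nat) (s : lcrw_state) : nat :=
  count (fun e : edge => e.2 \notin visited x s) (out_edges f (top_block x s)).

Definition prefixes (x : vertex) : seq vertex :=
  [seq take j x | j <- iota 0 (size x).+1].

Lemma mem_prefixes x v : (v \in prefixes x) = prefix v x.
Proof.
apply/mapP/idP => [[j _ ->]|pv]; first exact: prefix_take.
exists (size v); first by rewrite mem_iota /= add0n ltnS size_prefix.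
by move: pv; rewrite prefixE => /eqP.
Qed.

Lemma uniq_prefixes x : uniq (prefixes x).
Proof.
rewrite map_inj_in_uniq ?iota_uniq// => i j; rewrite !mem_iota /= !add0n !ltnS.
by move=> ix jx /(congr1 size); rewrite !size_takel.
Qed.

(* Decreases whenever an ancestor of [x] is pushed and whenever a block entered
   at an ancestor of [x] is popped: these steps, finitely many, escape the fresh
   offspring law (and a block of ancestors may have no unexplored edge at all). *)
Definition ancestor_weight x (s : lcrw_state) : nat :=
  2 * count (fun v => v \notin visited x s) (prefixes x) +
  count (fun e : edge => prefix e.2 x) s.2.

(** A deepest vertex of a block has its children outside the block; this is how outgoing edges are
    found. *)
Lemma exists_max_size (X : seq vertex) (a : pred vertex) : has a X ->
  exists u, [/\ u \in X, a u & forall v, v \in X -> a v -> (size v <= size u)%N].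
Proof.
elim: X => //= y X IH; case: (boolP (has a X)) => [hX _|hX].
  have [u [uX au um]] := IH hX.
  case: (boolP (a y && (size u < size y)%N)) => [/andP[ay uy]|nu].
    exists y; split; rewrite ?inE ?eqxx// => v; rewrite inE => /orP[/eqP->//|vX] av.
    exact/(leq_trans (um _ vX av))/ltnW.
  exists u; split; rewrite ?inE ?uX ?orbT// => v; rewrite inE => /orP[/eqP->|vX] av; last exact: um.
  by move: nu; rewrite av /= -leqNgt.
rewrite orbF => ay; exists y; split; rewrite ?inE ?eqxx// => v.
by rewrite inE => /orP[/eqP->//|vX] av; case/hasP: hX; exists v.
Qed.

Lemma rcons_nbrs f u i : (i < f u)%N -> rcons u i \in nbrs f u.
Proof. by move=> iu; rewrite mem_cat map_f// mem_iota. Qed.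

Section degrees.
Variables (x : vertex) (s : lcrw_state) (f : vertex -> nat).
Hypothesis inv : walk_inv x s.
Hypothesis f_gt0 : forall u, (0 < f u)%N.
Let X := top_block x s.
Let O := out_edges f X.

Lemma uniq_top : uniq X.
Proof.
have := inv_uniq inv; rewrite /visited /blocks /reps lastI map_rcons flatten_rcons.
by rewrite cat_uniq -/(top_rep x s) -top_blockE => /and3P[].
Qed.

Lemma uniq_out_top : uniq O.
Proof. exact/uniq_out_edges/uniq_top. Qed.

Lemma count_visited_le1 :
  (count (fun e : edge => e.2 \in visited x s) O <= (s.2 != [::]))%N.
Proof.
set a := fun e : edge => _.
have h e : e \in O -> a e ->
    e = (top_rep x s, toward x (top_rep x s)) /\ s.2 != [::].
  case: e => u w; rewrite mem_out_edges => /and3P[uX wu wX] wv.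
  by have [-> -> ->] := out_edge_visited inv uX wu wX wv.
have [s0|sn0] := eqVneq s.2 [::].
  rewrite leqn0 eqn0Ngt -has_count; apply/hasPn => e eO; apply/negP => ae.
  by have [_] := h _ eO ae; rewrite s0.
rewrite -size_filter; apply: (@leq_trans (size [:: (top_rep x s, toward x (top_rep x s))])) => //.
apply: uniq_leq_size; first exact/filter_uniq/uniq_out_top.
by move=> e; rewrite mem_filter inE => /andP[ae eO]; have [->] := h _ eO ae.
Qed.

Lemma size_out_top : size O =
  (fresh_degree x f s + count (fun e : edge => e.2 \in visited x s) O)%N.
Proof.
rewrite addnC -(count_predC (fun e : edge => e.2 \in visited x s)).
by congr (_ + _).
Qed.

(** Off the prefixes of [x], the geodesic to [x] goes through the parent, so the edge to a child
    cannot be the return edge. *)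
Lemma child_fresh u i : u \in X -> ~~ prefix u x -> (i < f u)%N ->
  rcons u i \notin X -> rcons u i \notin visited x s.
Proof.
move=> uX pu iu cX; apply/negP => cv.
have [_ + _] := out_edge_visited inv uX (rcons_nbrs iu) cX cv.
rewrite /toward (negbTE pu) => /(congr1 size); rewrite size_rcons size_take_min => su.
by have := geq_minr (size u).-1 (size u); rewrite -su ltnn.
Qed.

Lemma out_top_neq0 : O != [::].
Proof.
have [|u [uX _ um]] := @exists_max_size X predT.
  by apply/hasP; exists (top_rep x s) => //; exact: top_rep_mem.
have : (u, rcons u 0) \in O.
  rewrite mem_out_edges uX rcons_nbrs//=; apply/negP => cX.
  by have := um _ cX isT; rewrite size_rcons ltnn.
by case: O.
Qed.

(** Take a deepest vertex of the block among those that are not prefixes of [x]. Its first child is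
    again not a prefix of [x], hence lies outside the block and is unexplored. *)
Lemma fresh_degree_gt0 : s.2 != [::] -> ~~ prefix (top_rep x s) x ->
  (0 < fresh_degree x f s)%N.
Proof.
move=> s0 pr; have [|u [uX pu um]] := @exists_max_size X (fun v => ~~ prefix v x).
  by apply/hasP; exists (top_rep x s) => //; exact: top_rep_mem.
have cX : rcons u 0 \notin X.
  have pc : ~~ prefix (rcons u 0) x.
    by apply: contra pu; apply: prefix_trans; exact: prefix_rcons.
  by apply/negP => cX; have := um _ cX pc; rewrite size_rcons ltnn.
rewrite -has_count; apply/hasP; exists (u, rcons u 0).
  by rewrite mem_out_edges uX rcons_nbrs.
exact: child_fresh.
Qed.

Lemma size_out_gt0 : (0 < size O)%N.
Proof. by rewrite lt0n size_eq0 out_top_neq0. Qed.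

End degrees.

(** * Change of the degree and of the ancestor weight in one step *)

Section fresh_step_weight.
Variables (x : vertex) (s : lcrw_state) (f g : vertex -> nat) (e : edge).
Hypothesis inv : walk_inv x s.
Hypothesis eO : e \in out_edges g (top_block x s).
Hypothesis fresh : e.2 \notin visited x s.
Let s' := (s.1, rcons s.2 e).

(** The geodesic from [e.2] to [x] goes through its parent, so all children of [e.2] are
    unexplored. *)
Lemma fresh_degree_fresh : ~~ prefix e.2 x -> (f e.2 <= fresh_degree x f s')%N.
Proof.
move=> pe; have inv' := walk_inv_fresh inv eO fresh.
have tX := top_block_fresh inv fresh.
rewrite /fresh_degree -size_filter tX.
rewrite -[leqLHS](size_iota 0) -(size_map (fun i => (e.2, rcons e.2 i))).
apply: uniq_leq_size.
  by rewrite map_inj_uniq ?iota_uniq// => i j /(congr1 snd)/=; exact: rcons_injr.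
move=> _ /mapP[i + ->]; rewrite mem_iota /= add0n => ie.
have cX : rcons e.2 i \notin top_block x s'.
  rewrite tX inE; apply/eqP => /(congr1 size); rewrite size_rcons; lia.
rewrite mem_filter mem_out_edges inE eqxx rcons_nbrs//= -tX cX andbT.
by apply: (child_fresh inv' _ pe ie) => //; rewrite tX inE.
Qed.

(** Pushing a prefix of [x] lowers the first term by two and raises the second by one, which leaves
    one unit to be lost at the pop. *)
Lemma ancestor_weight_fresh :
  (ancestor_weight x s' + prefix e.2 x <= ancestor_weight x s)%N.
Proof.
rewrite /ancestor_weight (visited_fresh inv fresh) -[s'.2]/(rcons s.2 e).
rewrite -[rcons s.2 e]cats1 count_cat [count _ [:: e]]/= addn0.
set a := count (fun v => v \notin rcons _ _) _.
set b := count (fun v => v \notin visited x s) _.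
suff : (a + prefix e.2 x <= b)%N by lia.
rewrite /a /b -mem_prefixes -count_uniq_mem ?uniq_prefixes// -count_predUI.
rewrite [count (predI _ _) _](_ : _ = 0%N); last first.
  apply/eqP; rewrite eqn0Ngt -has_count; apply/hasPn => v _ /=.
  by rewrite mem_rcons inE negb_or -andbA andbCA andNb andbF.
rewrite addn0; apply: sub_count => v /=; rewrite mem_rcons inE negb_or.
by case/orP => [/andP[]//|/eqP->].
Qed.

End fresh_step_weight.

Section back_step_weight.
Variables (x : vertex) (s : lcrw_state) (f g : vertex -> nat) (e e0 : edge).
Variable P : seq edge.
Hypothesis inv : walk_inv x s.
Hypothesis eO : e \in out_edges g (top_block x s).
Hypothesis back : e.2 \in visited x s.
Hypothesis sP : s.2 = rcons P e0.
Let s' := step_along x e s.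

Lemma step_along_back_path : s'.2 = P.
Proof. by rewrite /s' (step_along_back inv eO back sP). Qed.

Lemma walk_inv_step_back : walk_inv x s'.
Proof. rewrite /s' (step_along_back inv eO back sP); exact: (walk_inv_back inv sP). Qed.

Lemma visited_step_back : visited x s' = visited x s.
Proof. rewrite /s' (step_along_back inv eO back sP); exact: (visited_back inv sP). Qed.

(** A merge leaves the visited set unchanged, so the unexplored heads of the old top block stay
    outside the merged block. *)
Lemma fresh_degree_back : (fresh_degree x f s <= fresh_degree x f s')%N.
Proof.
rewrite /fresh_degree visited_step_back -!size_filter; apply: uniq_leq_size.
  exact/filter_uniq/uniq_out_top.
case=> u w; rewrite !mem_filter !mem_out_edges /= => /and4P[wv uX wu wX].
rewrite wv wu /s' (step_along_back inv eO back sP) (top_block_back inv sP).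
rewrite mem_cat uX orbT /=; apply: contra wv => wU; rewrite -(visited_back inv sP).
by apply: top_sub_visited; rewrite (top_block_back inv sP).
Qed.

Lemma ancestor_weight_back :
  (ancestor_weight x s' + prefix (top_rep x s) x = ancestor_weight x s)%N.
Proof.
rewrite /ancestor_weight visited_step_back step_along_back_path sP.
by rewrite -cats1 count_cat (top_rep_rcons x sP) /= addn0 addnA.
Qed.

End back_step_weight.

Local Open Scope ring_scope.

(* [alpha] is the mean of [psi] over a freshly pushed vertex. *)
Record drift_constants (R : realType) (alpha lam c rho : R) : Prop :=
  DriftConstants {
  dc_lam0 : 0 < lam; dc_lam1 : lam <= 1;
  dc_c0 : 0 < c; dc_c1 : c <= 1;
  dc_rho0 : 0 < rho; dc_rho1 : rho < 1;
  dc_root : lam <= rho * c;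
  dc_one : lam * alpha + lam^-1 <= 2 * rho;
  dc_two : c * lam^-1 + 2 * (lam * alpha) <= 3 * (rho * c);
  dc_pop : 1 / 2 <= lam * rho;
  dc_push : 1 / 2 <= alpha; dc_alpha1 : alpha <= 1 }.

(** With [t] a tenth of [1 - p1], the choices [lam = 1 - t] and [c = 1 - t / 4] give
    [alpha = 1 - 5 t^2 / 2]. In [dc_one] the first order cancels and the loss [5/2] in [alpha] beats
    the [10/9] coming from [lam^-1]; [dc_root] and [dc_two] have slack of order [t]. So
    [rho = 1 - t^2 / 100] is admissible. *)
Lemma drift_constants_exist (R : realType) (p1 : R) : 0 <= p1 -> p1 < 1 ->
  exists lam c rho, drift_constants (p1 + (1 - p1) * c) lam c rho.
Proof.
move=> p0 p1lt; set t := (1 - p1) / 10%:R.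
have t0 : 0 < t by rewrite /t; lra.
have t1 : t <= 1 / 10%:R by rewrite /t; lra.
have pt : 1 - p1 = 10%:R * t by rewrite /t; field.
have -> : p1 = 1 - 10%:R * t by lra.
(* This quadratic bound, valid for [t <= 1/10], turns the constraints with an inverse into
   polynomial inequalities. *)
have il : (1 - t)^-1 <= 1 + t + (10%:R / 9%:R) * t ^+ 2.
  rewrite -[leLHS]mul1r ler_pdivrMr; last lra.
  rewrite -subr_ge0 (_ : _ - _ = t ^+ 2 / 9%:R * (1 - 10%:R * t)); last by field.
  apply: mulr_ge0; last lra.
  by apply: divr_ge0 => //; exact: sqr_ge0.
have t2 : 0 < t ^+ 2 by rewrite exprn_gt0.
have t2' : t ^+ 2 <= t / 10%:R by rewrite expr2; nra.
have t3 : t ^+ 3 <= t ^+ 2 / 10%:R by rewrite exprSr; nra.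
have t3' : 0 < t ^+ 3 by rewrite exprn_gt0.
exists (1 - t), (1 - t / 4%:R), (1 - t ^+ 2 / 100%:R).
have -> : 1 - 10%:R * t + (1 - (1 - 10%:R * t)) * (1 - t / 4%:R) =
  1 - 10%:R / 4%:R * t ^+ 2 by field.
have la : (1 - t) * (1 - 10%:R / 4%:R * t ^+ 2) =
  1 - t - 10%:R / 4%:R * t ^+ 2 + 10%:R / 4%:R * t ^+ 3 by ring.
have rc : (1 - t ^+ 2 / 100%:R) * (1 - t / 4%:R) =
  1 - t / 4%:R - t ^+ 2 / 100%:R + t ^+ 3 / 400%:R by field.
split; rewrite ?la ?rc; try lra.
- have cl : (1 - t / 4%:R) * (1 - t)^-1 <=
      (1 - t / 4%:R) * (1 + t + (10%:R / 9%:R) * t ^+ 2).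
    by apply: ler_wpM2l => //; lra.
  have cl' : (1 - t / 4%:R) * (1 + t + (10%:R / 9%:R) * t ^+ 2) =
     1 + 3%:R / 4%:R * t + (31%:R / 36%:R) * t ^+ 2 - (10%:R / 36%:R) * t ^+ 3 by field.
  lra.
Qed.

Lemma sumr_if_count (R : realType) (T : Type) (a : pred T) (A B : R) (l : seq T) :
  \sum_(e <- l) (if a e then B else A) =
  (count a l)%:R * B + (count (predC a) l)%:R * A.
Proof.
elim: l => [|y l IH]; first by rewrite big_nil /= !mul0r addr0.
by rewrite big_cons IH /=; case: (a y); rewrite /= ?add0n ?add1n ?natr1 -?natr1; ring.
Qed.

(** * The Lyapunov function and its drift *)

Section lyapunov.
Variables (R : realType) (alpha lam c rho : R) (x : vertex).
Hypothesis dc : drift_constants alpha lam c rho.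

(** The function [lam ^ L * psi] with an extra factor that is at least halved whenever an ancestor
    of [x] is pushed or popped. The empty path also gets [psi = c]: no edge leads back from the root
    block, so every step there is a push. *)
Definition lyap (f : vertex -> nat) (s : lcrw_state) : R :=
  lam ^+ size s.2 * 2 ^+ ancestor_weight x s *
  (if (s.2 == [::]) || (2 <= fresh_degree x f s)%N then c else 1).

Let lam_ge0 : 0 <= lam. Proof. exact/ltW/(dc_lam0 dc). Qed.

Lemma lyap_ge0 f s : 0 <= lyap f s.
Proof.
rewrite /lyap !mulr_ge0 ?exprn_ge0//; case: ifP => // _; exact/ltW/(dc_c0 dc).
Qed.

(** Prepares Markov's inequality: the indicator of a short path is at most [lyap] divided by
    [lam ^+ n * c]. *)
Lemma lyap_lb f s n : (size s.2 <= n)%N -> lam ^+ n * c <= lyap f s.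
Proof.
move=> sn; rewrite /lyap; apply: ler_pM.
- exact: exprn_ge0.
- exact/ltW/(dc_c0 dc).
- rewrite -[leLHS]mulr1; apply: ler_pM; rewrite ?exprn_ge0//.
    by rewrite ler_wiXn2l// (dc_lam1 dc).
  by rewrite exprn_ege1// ler1n.
- by case: ifP => // _; exact: (dc_c1 dc).
Qed.

Section drift.
Variables (s : lcrw_state) (f : vertex -> nat).
Hypothesis inv : walk_inv x s.
Hypothesis f_gt0 : forall u, (0 < f u)%N.
Let O := out_edges f (top_block x s).

(** Bounds the expectation of [lyap] after a push, when the offspring number of the pushed vertex is
    fresh. *)
Definition push_bound : R := lam ^+ (size s.2).+1 * 2 ^+ ancestor_weight x s * alpha.

(** The environment [g] may differ from [f]: it will be [f] with the offspring number of the pushed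
    vertex replaced by a newly revealed value. *)
Lemma lyap_push_le g (e : edge) : e \in O -> e.2 \notin visited x s ->
  lyap g (s.1, rcons s.2 e) <= lam ^+ (size s.2).+1 * 2 ^+ ancestor_weight x s *
    (if prefix e.2 x then 1 / 2 else
     if (1 < g e.2)%N then c else 1).
Proof.
move=> eO ev; have aw := ancestor_weight_fresh inv eO ev.
rewrite /lyap size_rcons -!mulrA ler_wpM2l ?exprn_ge0//.
have psi1 b : (if b then c else 1) <= 1 by case: b => //; exact: (dc_c1 dc).
have psi0 b : 0 <= (if b then c else 1).
  by case: b => //; exact/ltW/(dc_c0 dc).
have [pe|pe] := boolP (prefix e.2 x); rewrite ?pe ?(negbTE pe) in aw *.
  rewrite addn1 in aw; rewrite mul1r -[leRHS]mulr1 -mulrA.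
  case: (ancestor_weight x s) aw => // m aw.
  rewrite exprSr -mulrA mulVKf// ler_pM ?exprn_ge0//.
  by rewrite ler_weXn2l// ler1n.
rewrite addn0 in aw.
rewrite ler_pM ?exprn_ge0//; first by rewrite ler_weXn2l// ?ler1n.
rewrite [_ == [::]](_ : _ = false); last by case: (s.2).
have := fresh_degree_fresh g inv eO ev pe.
rewrite orFb => gd; case: (leqP 2 (g e.2)) => // g1.
by rewrite (leq_trans g1 gd).
Qed.

(** After a merge, or a push of an ancestor of [x], every relevant offspring number is already
    revealed and the cost is the value itself; for any other push it is a bound on the mean. *)
Definition step_cost (e : edge) : R :=
  if e.2 \in visited x s then lyap f (step_along x e s) else
  if prefix e.2 x then lyap f (s.1, rcons s.2 e) else push_bound.

Lemma step_cost_fresh e : e \in O -> e.2 \notin visited x s ->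
  step_cost e <= push_bound.
Proof.
move=> eO ev; rewrite /step_cost (negbTE ev); case: ifPn => // pe.
apply: le_trans (lyap_push_le f eO ev) _; rewrite pe.
by rewrite ler_wpM2l ?(dc_push dc)// mulr_ge0 ?exprn_ge0.
Qed.

(** At most one edge returns, and it costs at most the current value with one factor [lam] removed;
    every other edge costs at most [push_bound]. The bound [dc_root] serves for the empty path; with
    a return edge, [dc_one], [dc_two] and [dc_pop] serve for [a = 1], [a >= 2] and [a = 0]. *)
Lemma lyap_drift : \sum_(e <- O) step_cost e <= (size O)%:R * rho * lyap f s.
Proof.
have ub B : (forall e, e \in O -> e.2 \in visited x s -> step_cost e <= B) ->
  \sum_(e <- O) step_cost e <=
    (count (fun e : edge => e.2 \in visited x s) O)%:R * B +
    (fresh_degree x f s)%:R * push_bound.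
  move=> hB; rewrite -(sumr_if_count (fun e : edge => e.2 \in visited x s)).
  rewrite big_seq [leRHS]big_seq; apply: ler_sum => e eO; case: ifPn => ev.
    exact: hB.
  exact: step_cost_fresh.
have := count_visited_le1 f inv; have := size_out_top x s f; have := size_out_gt0 inv f_gt0.
rewrite -/O; set nb := count _ O; set a := fresh_degree x f s.
have [sP|[P [e0 sP]]] : s.2 = [::] \/ exists P e0, s.2 = rcons P e0.
    by case/lastP: (s.2) => [|P e0]; [left|right; exists P, e0].
  rewrite {1}sP leqn0 => so e1 /eqP nb0; rewrite nb0 addn0 in e1.
  apply: le_trans (ub 0 _) _.
    move=> e eO ev; have : (0 < nb)%N by rewrite -has_count; apply/hasP; exists e.
    by rewrite nb0.
  rewrite mulr0 add0r e1 -mulrA ler_wpM2l//.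
  have -> : push_bound = 2 ^+ ancestor_weight x s * (lam * alpha).
    by rewrite /push_bound sP expr1; ring.
  have -> : rho * lyap f s = 2 ^+ ancestor_weight x s * (rho * c).
    by rewrite /lyap sP eqxx orTb [size [::]]/= expr0; ring.
  rewrite ler_wpM2l ?exprn_ge0//; apply: le_trans (dc_root dc).
  by rewrite -[leRHS]mulr1 ler_wpM2l// (dc_alpha1 dc).
have -> : s.2 != [::] by rewrite sP; case: (P).
move=> o0 oe nb1.
set L := lam ^+ size P; set M := 2 ^+ ancestor_weight x s : R.
have L0 : 0 <= L by exact: exprn_ge0.
have M0 : 0 <= M by exact: exprn_ge0.
have pbE : push_bound = L * M * (lam * (lam * alpha)).
  by rewrite /push_bound sP size_rcons !exprSr -/L -/M; ring.
have lyE : lyap f s = L * M * (lam * (if (2 <= a)%N then c else 1)).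
  rewrite /lyap {1 2}sP size_rcons exprSr -/L -/M.
  rewrite [_ == [::]](_ : _ = false); last by case: (P).
  by rewrite orFb -/a; ring.
have lam_neq0 : lam != 0 by exact/lt0r_neq0/(dc_lam0 dc).
have c0 := ltW (dc_c0 dc).
have back e : e \in O -> e.2 \in visited x s -> step_cost e <=
  L * M * (if prefix (top_rep x s) x then 1 / 2 else 1) *
  (if (2 <= a)%N then c else 1).
  move=> eO ev; rewrite /step_cost ev /lyap (step_along_back_path inv eO ev sP) -/L.
  have aw := ancestor_weight_back inv eO ev sP.
  have fd := fresh_degree_back f inv eO ev sP.
  rewrite -!mulrA ler_wpM2l// mulrA ler_pM ?exprn_ge0//.
  - by case: ifP.
  - rewrite /M -aw; case: ifPn => _; last by rewrite [nat_of_bool _]/= addn0 mulr1.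
    by rewrite [nat_of_bool _]/= addn1 exprSr mul1r mulfK.
  - case: (leqP 2 a) => a2; first by rewrite (leq_trans a2 fd) orbT.
    by case: ifP => // _; exact: (dc_c1 dc).
apply: le_trans (ub _ back) _; rewrite pbE lyE oe natrD.
set pr := (if prefix _ _ then _ else _); set ps := (if _ then c else 1).
have ps0 : 0 <= ps by rewrite /ps; case: ifP.
have pr1 : pr <= 1 by rewrite /pr; case: ifP => // _; lra.
suff main : nb%:R * (pr * ps) + a%:R * (lam * (lam * alpha)) <=
    (a%:R + nb%:R) * rho * (lam * ps).
  have -> : nb%:R * (L * M * pr * ps) + a%:R * (L * M * (lam * (lam * alpha))) =
    L * M * (nb%:R * (pr * ps) + a%:R * (lam * (lam * alpha))) by ring.
  have -> : (a%:R + nb%:R) * rho * (L * M * (lam * ps)) =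
    L * M * ((a%:R + nb%:R) * rho * (lam * ps)) by ring.
  by rewrite ler_wpM2l// mulr_ge0.
have la : lam * alpha <= rho * c.
  apply: le_trans (dc_root dc); rewrite -[leRHS]mulr1 ler_wpM2l//.
  exact: (dc_alpha1 dc).
have rc : rho * c <= rho.
  by rewrite -[leRHS]mulr1 ler_wpM2l ?(dc_c1 dc)// (ltW (dc_rho0 dc)).
have [h1 h2] := (dc_one dc, dc_two dc).
have il1 : lam * lam^-1 = 1 by rewrite mulfV.
have il0 : 0 <= lam^-1 by rewrite invr_ge0.
have nb01 : nb = 0%N \/ nb = 1%N by case: (nb) nb1 => [|[]]; [left|right|].
have [a2|a2] := leqP 2 a.
  rewrite /ps a2.
  (* Each unexplored edge beyond the second is absorbed by [lam * alpha <= rho * c], which reduces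
     to [dc_two]. *)
  have [b ab] : exists b : nat, a = (b + 2)%N by exists (a - 2)%N; rewrite subnK.
  have b0 : 0 <= (b%:R : R) by [].
  have hb : b%:R * (lam * alpha) <= b%:R * (rho * c) by exact: ler_wpM2l.
  rewrite ab natrD; case: nb01 => ->.
    rewrite mul0r add0r addr0.
    have : lam * ((b%:R + 2) * (lam * alpha)) <= lam * ((b%:R + 2) * (rho * c)).
      by do 2 apply: ler_wpM2l => //; lra.
    by move=> h; apply: (etrans _ h); congr (_ <= _); ring.
  have key : c * lam^-1 + (b%:R + 2) * (lam * alpha) <= (b%:R + 2 + 1) * (rho * c) by lra.
  have := ler_wpM2l lam_ge0 key; rewrite mulrDr mulrCA il1 mulr1.
  rewrite mul1r => key'; apply: le_trans (le_trans _ key') _.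
    by rewrite (mulrCA lam (b%:R + 2)) lerD2r -[leRHS]mul1r ler_wpM2r.
  by rewrite le_eqVlt; apply/orP; left; apply/eqP; ring.
rewrite /ps leqNgt a2 /= !mulr1.
(* Without unexplored edges the step is a sure pop. The block was then entered at a prefix of [x],
   and the halved ancestor factor provides the decay. *)
have [a0|a0] := posnP a.
  have n1 : nb = 1%N by case: nb01 => // n0; move: o0; rewrite oe a0 n0.
  rewrite a0 n1 mul0r addr0 add0r !mul1r /pr.
  case: ifPn => [_|np]; first by have := dc_pop dc; lra.
  have := fresh_degree_gt0 inv f_gt0 _ np; rewrite sP -/a a0.
  by case: (P) => [|? ?] /(_ isT).
have -> : a = 1%N by apply/eqP; rewrite eqn_leq a0 -ltnS a2.
case: nb01 => ->.
  rewrite !mul0r !mul1r addr0 add0r mul1r (mulrC rho) ler_wpM2l//.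
  exact: le_trans rc.
have := ler_wpM2l lam_ge0 h1; rewrite mulrDr il1 !mul1r => key.
by rewrite mulrC; nra.
Qed.
End drift.
End lyapunov.

(** * Annealed estimates *)

Local Open Scope classical_set_scope.

(* Probability that, [t] steps after state [s], the path has length at most [n].
   When there is no outgoing edge, [(size O).-1.+1 = 1] and the step is idle. *)
Fixpoint short_prob (R : realType) (f : vertex -> nat) x (n t : nat)
    (s : lcrw_state) : R :=
  if t is t'.+1 then
    let O := out_edges f (top_block x s) in
    (size O).-1.+1%:R^-1 *
      \sum_(k < (size O).-1.+1) short_prob R f x n t' (step_among x O k s)
  else (size s.2 <= n)%N%:R.

Lemma short_prob_ge0 (R : realType) f x n t s : 0 <= short_prob R f x n t s.
Proof.
elim: t s => [|t IH] s /=; first exact: ler0n.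
by rewrite mulr_ge0 ?invr_ge0 ?ler0n// sumr_ge0.
Qed.

(** Gluing over the countably many fibres of [G], typically the list of offspring numbers in a
    block, which fixes its outgoing edges. *)
Lemma measurable_fun_countable_case (R : realType) d (Omega : measurableType d)
    (T : countType) (G : Omega -> T) (F : T -> Omega -> R) :
  (forall o, measurable (G @^-1` [set o])) ->
  (forall o, measurable_fun setT (F o)) ->
  measurable_fun setT (fun w => F (G w) w).
Proof.
move=> mG mF _ B mB; rewrite setTI.
rewrite (_ : _ @^-1` B = \bigcup_o ((G @^-1` [set o]) `&` (F o @^-1` B))).
  apply: countable_bigcupT_measurable => [|o]; first exact: countableP.
  by apply: measurableI => //; rewrite -[X in measurable X]setTI; exact: mF.
apply/seteqP; split=> [w Bw|w [y _ [<-]]]; last by [].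
by exists (G w).
Qed.

(** * Measurability and partially revealed environments *)

Section annealed.
Variables (R : realType) (d : measure_display) (Omega : measurableType d).
Variables (P : probability Omega R) (law : vertex -> nat -> R).
Variable xi : vertex -> Omega -> nat.
Hypothesis xi_law : indep_family_with_laws P law xi.

Let tree (w : Omega) : vertex -> nat := fun u => xi u w.

Lemma measurable_xi_preimage u (B : set nat) : measurable (xi u @^-1` B).
Proof. by rewrite -[X in measurable X]setTI; case: xi_law => mxi _ _; exact: mxi. Qed.

Lemma measurable_map_xi (X : seq vertex) l :
  measurable ((fun w => [seq xi u w | u <- X]) @^-1` [set l]).
Proof.
elim: X l => [|u X IH] l.
  have [->|l0] := eqVneq l [::].
    by rewrite (_ : _ @^-1` _ = setT)//; apply/seteqP.
  rewrite (_ : _ @^-1` _ = set0)//; apply/seteqP; split=> // w /= e.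
  by rewrite -e eqxx in l0.
case: l => [|k l].
  by rewrite (_ : _ @^-1` _ = set0)//; apply/seteqP; split=> w.
rewrite (_ : _ @^-1` _ = (xi u @^-1` [set k]) `&`
   ((fun w => [seq xi u w | u <- X]) @^-1` [set l])).
  by apply: measurableI => //; exact: measurable_xi_preimage.
by apply/seteqP; split=> w /= [-> ->].
Qed.

Lemma measurable_short_prob x n t s :
  measurable_fun setT (fun w => short_prob R (tree w) x n t s).
Proof.
elim: t s => [|t IH] s; first exact: measurable_cst.
set X := top_block x s.
(* Recomputes the outgoing edges from the list of offspring numbers read along [X]. *)
pose O (l : seq nat) := out_edges (fun u => nth 0%N l (index u X)) X.
have OE w : out_edges (tree w) X = O [seq xi u w | u <- X].
  by apply: eq_out_edges => u uX; rewrite (nth_map u) ?index_mem// nth_index.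
pose F (l : seq nat) w := (size (O l)).-1.+1%:R^-1 *
  \sum_(k < (size (O l)).-1.+1) short_prob R (tree w) x n t (step_among x (O l) k s).
rewrite (_ : (fun w => _) = (fun w => F [seq xi u w | u <- X] w)); last first.
  by apply/funext => w /=; rewrite -/X OE.
apply: (measurable_fun_countable_case (F := F)); first exact: measurable_map_xi.
move=> l; apply: measurable_funM => //; apply: measurable_sum => k.
exact: IH.
Qed.

Lemma measurable_short_probE x n t s D :
  measurable_fun D (fun w => (short_prob R (tree w) x n t s)%:E).
Proof.
apply: measurable_funTS; apply/measurable_EFinP; exact: measurable_short_prob.
Qed.

(** Conditioning on the explored part of the tree is expressed by integrating over these cylinder
    events. *)
Definition revealed (D : seq vertex) (b : vertex -> nat) : set Omega :=
  \big[setI/setT]_(u <- D) (xi u @^-1` [set b u]).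

Lemma measurable_revealed D b : measurable (revealed D b).
Proof. by apply: bigsetI_measurable => u _; exact: measurable_xi_preimage. Qed.

Lemma revealedP D b w : revealed D b w <-> (forall u, u \in D -> xi u w = b u).
Proof.
rewrite /revealed; elim: D => [|u D IH]; first by rewrite big_nil.
rewrite big_cons; split=> [[/= xu /IH h] v|h].
  by rewrite inE => /orP[/eqP->//|]; exact: h.
split=> /=; first by apply: h; rewrite inE eqxx.
by apply/IH => v vD; apply: h; rewrite inE vD orbT.
Qed.

Definition upd (b : vertex -> nat) u j : vertex -> nat :=
  fun v => if v == u then j else b v.

Lemma revealed_cons D b u j : u \notin D ->
  revealed (u :: D) (upd b u j) = revealed D b `&` (xi u @^-1` [set j]).
Proof.
move=> uD; apply/seteqP; split=> w.
  move=> /revealedP h; split; last by have := h u; rewrite /upd eqxx inE eqxx; exact.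
  apply/revealedP => v vD; rewrite h ?inE ?vD ?orbT// /upd ifF//.
  by apply/negP => /eqP vu; rewrite -vu vD in uD.
case=> /revealedP h wj; apply/revealedP => v; rewrite inE /upd.
by case: eqP => [-> _|_ /= vD]; [exact: wj|exact: h].
Qed.

Lemma prob_revealed_cons D b u j : uniq D -> u \notin D ->
  P (revealed (u :: D) (upd b u j)) = ((law u j)%:E * P (revealed D b))%E.
Proof.
move=> uD nuD; have [_ xp ind] := xi_law.
rewrite /revealed (ind _ (fun v => [set upd b u j v])) ?(ind _ (fun v => [set b v]))//=.
  rewrite big_cons /upd eqxx xp; congr (_ * _)%E.
  apply: eq_big_seq => v vD; rewrite ifF//.
  by apply/negP => /eqP vu; rewrite -vu vD in nuD.
by rewrite nuD.
Qed.

End annealed.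

Lemma nneseries_single (R : realType) (M : R) (i : nat) : 0 <= M ->
  (\sum_(j <oo) (if j == i then M else 0)%:E = M%:E)%E.
Proof.
move=> M0; rewrite (@nneseries_split _ _ 0 i.+1); last first.
  by move=> k _; rewrite lee_fin; case: ifP.
rewrite add0n eseries0 ?adde0; last first.
  by move=> k ik _; rewrite ifF//; apply/negbTE; rewrite neq_ltn ik orbT.
rewrite big_nat_recr//= eqxx big_nat big1 ?add0e// => k /andP[_ ki].
by rewrite ifF//; apply/negbTE; rewrite neq_ltn ki.
Qed.

(** * Exponential decay under the annealed law *)

Section annealed_bound.
Variables (R : realType) (d : measure_display) (Omega : measurableType d).
Variables (P : probability Omega R) (law : vertex -> nat -> R) (p : nat -> R).
Variable xi : vertex -> Omega -> nat.
Hypothesis xi_law : indep_family_with_laws P law xi.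
Hypothesis law_p : forall u, u != [::] -> law u = p.
Hypothesis offp : offspring_law p.
Hypothesis p0 : p 0%N = 0.
Variables (lam c rho : R).
Hypothesis dc : drift_constants (p 1%N + (1 - p 1%N) * c) lam c rho.
Variables (x : vertex) (n : nat).

Let tree (w : Omega) : vertex -> nat := fun u => xi u w.
Let v t s w : R := short_prob R (tree w) x n t s.
Let E D b := revealed xi D b.
Let C : R := (lam ^+ n * c)^-1.

Let C0 : 0 < C.
Proof. by rewrite invr_gt0 mulr_gt0 ?exprn_gt0 ?(dc_lam0 dc) ?(dc_c0 dc). Qed.

Let mE D b : measurable (E D b). Proof. exact: measurable_revealed xi_law _ _. Qed.

(** The series is the mean of [psi] at a freshly pushed vertex. As [p 0] vanishes, [psi] may be
    taken as [c] plus [1 - c] at offspring number 1. *)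
Lemma psi_series_le : (\sum_(j <oo) (p j * (if (1 < j)%N then c else 1))%:E <=
  (p 1%N + (1 - p 1%N) * c)%:E)%E.
Proof.
have [pge0 p1] := offp.
have c0 := ltW (dc_c0 dc); have c1 := dc_c1 dc.
apply: (@le_trans _ _ (\sum_(j <oo) (c%:E * (p j)%:E +
    (if j == 1%N then (1 - c) * p 1%N else 0)%:E))%E).
  apply: lee_nneseries => [j _ _|j _]; rewrite lee_fin.
    by rewrite mulr_ge0//; case: ifP.
  case: j => [|[|j]]; rewrite ?p0 /=; first by rewrite mul0r mulr0 addr0.
    lra.
  by rewrite addr0 mulrC.
rewrite nneseriesD; last 2 first.
- by move=> j _ _; rewrite lee_fin mulr_ge0.
- by move=> j _ _; rewrite lee_fin; case: ifP => // _; rewrite mulr_ge0// subr_ge0.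
rewrite nneseriesZl; last by move=> j _; rewrite lee_fin.
rewrite p1 nneseries_single ?mulr_ge0 ?subr_ge0// mule1 lee_fin.
lra.
Qed.

Lemma fine_revealed D b : P (E D b) = (fine (P (E D b)))%:E.
Proof. by rewrite fineK// fin_num_measure//. Qed.

(** Induction on [t], over all states and cylinder events at once. Since [D] contains the visited
    vertices, the outgoing edges are constant on the event; each contributes at most its
    [step_cost], and [lyap_drift] yields the factor [rho]. *)
Lemma annealed_short_prob t s D b :
  walk_inv x s -> uniq D -> D =i visited x s ++ prefixes x ->
  (forall u, (0 < b u)%N) ->
  (\int[P]_(w in E D b) (v t s w)%:E <=
   P (E D b) * (rho ^+ t * C * lyap lam c x b s)%:E)%E.
Proof.
have c0 := ltW (dc_c0 dc); have c1 := dc_c1 dc.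
have lam0 := ltW (dc_lam0 dc); have rho0 := ltW (dc_rho0 dc).
elim: t s D b => [|t IH] s D b inv uD DE b0.
  rewrite expr0 mul1r muleC -integral_cst//; apply: ge0_le_integral => //.
  - by move=> w _; rewrite lee_fin.
  - exact: (measurable_short_probE xi_law).
  - move=> w _; rewrite lee_fin /v /=; case: leqP => sn.
      rewrite /C mulrC ler_pdivlMr ?mulr_gt0 ?exprn_gt0 ?(dc_lam0 dc) ?(dc_c0 dc)//.
      by rewrite mul1r; exact: lyap_lb dc _ _ _ sn.
    by rewrite mulr_ge0 ?(lyap_ge0 _ dc)// ltW.
set X := top_block x s; set O := out_edges b X.
have XD u : u \in X -> u \in D.
  by move=> uX; rewrite DE mem_cat top_sub_visited.
have OE w : E D b w -> out_edges (tree w) X = O.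
  by move=> /revealedP h; apply: eq_out_edges => u /XD; exact: h.
have sO : (0 < size O)%N by exact: size_out_gt0.
have szO : (size O).-1.+1 = size O by rewrite prednK.
set K := rho ^+ t * C.
have K0 : 0 <= K by apply: mulr_ge0; [exact: exprn_ge0|exact: (ltW C0)].
have step e : e \in O -> (\int[P]_(w in E D b) (v t (step_along x e s) w)%:E <=
    P (E D b) * (K * step_cost (p 1%N + (1 - p 1%N) * c) lam c x s b e)%:E)%E.
  move=> eO; rewrite /step_cost; case: ifPn => ev.
    have [P' [e0 sP]] : exists P' e0, s.2 = rcons P' e0.
      have := count_visited_le1 b inv.
      have : (0 < count (fun e : edge => e.2 \in visited x s) O)%N.
        by rewrite -has_count; apply/hasP; exists e.
      move=> /leq_trans h /h.
      by case/lastP: (s.2) => [//|P' e0 _]; exists P', e0.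
    apply: IH => //; first exact: walk_inv_step_back inv eO ev sP.
    by rewrite (visited_step_back inv eO ev sP).
  rewrite (step_along_fresh ev).
  have inv' := walk_inv_fresh inv eO ev.
  have visE : visited x (s.1, rcons s.2 e) ++ prefixes x =i
      e.2 :: (visited x s ++ prefixes x).
    move=> u; rewrite (visited_fresh inv ev); move: (visited x s) => V.
    by rewrite cat_rcons !(mem_cat, in_cons) orbCA.
  (* A pushed prefix of [x] already belongs to [D], so the induction hypothesis applies on the same
     event. *)
  case: ifPn => pe.
    apply: IH => // u; rewrite visE in_cons DE mem_cat.
    by case: eqP => // ->; rewrite mem_prefixes pe orbT.
  (* The offspring number of [e.2] is unrevealed, and its law is [p] because [e.2] is not the root;
     the event is split according to its value. *)
  have eD : e.2 \notin D by rewrite DE mem_cat negb_or ev mem_prefixes.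
  have en : e.2 != [::] by apply: contra pe => /eqP ->; exact: prefix0s.
  set s' := (s.1, rcons s.2 e) in inv' *.
  pose F j := E (e.2 :: D) (upd b e.2 j).
  have FE j : F j = E D b `&` (xi e.2 @^-1` [set j]) by exact: revealed_cons.
  have EF : E D b = \bigcup_j F j.
    apply/seteqP; split=> [w Ew|w [j _]]; last by rewrite FE => -[].
    by exists (xi e.2 w) => //; rewrite FE.
  set L : R := lam ^+ (size s.2).+1 * 2 ^+ ancestor_weight x s.
  have L0 : 0 <= L by rewrite mulr_ge0 ?exprn_ge0.
  set PE := fine (P (E D b)).
  have PE0 : 0 <= PE by rewrite fine_ge0.
  rewrite fine_revealed -/PE [X in (X <= _)%E](_ : _ =
      \sum_(j <oo) \int[P]_(w in F j) (v t s' w)%:E)%E; last first.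
    rewrite EF ge0_integral_bigcup//.
    - by move=> j; rewrite FE; apply: measurableI => //; exact: measurable_xi_preimage xi_law _ _.
    - exact: (measurable_short_probE xi_law).
    - by move=> w _; rewrite lee_fin short_prob_ge0.
    - apply/trivIsetP => i j _ _ ij; rewrite !FE; apply/seteqP; split=> // w.
      by move=> [[_ /= wi] [_ /= wj]]; rewrite -wi -wj eqxx in ij.
  have Fle j : (\int[P]_(w in F j) (v t s' w)%:E <=
      (PE * K * L)%:E * (p j * (if (1 < j)%N then c else 1))%:E)%E.
    have PF : P (F j) = (p j * PE)%:E.
      by rewrite /F /E (prob_revealed_cons xi_law)// law_p// EFinM -fine_revealed.
    (* The value 0 is treated apart: it has probability zero, and the induction hypothesis asks for
       positive offspring numbers. *)
    have [j0|j0] := posnP j; first rewrite j0 in PF *.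
      rewrite null_set_integral//; first by rewrite p0 mul0r mule0.
      - exact: mE.
      - exact: (measurable_short_probE xi_law).
      - by apply: (etrans PF); rewrite p0 mul0r.
    have pj0 : 0 <= p j by have [] := offp.
    apply: le_trans (IH s' (e.2 :: D) (upd b e.2 j) inv' _ _ _) _.
    - by rewrite /= eD.
    - by move=> u; rewrite visE !in_cons DE.
    - by move=> u; rewrite /upd; case: ifP.
    rewrite -/(F j) PF -!EFinM lee_fin -/K.
    have := lyap_push_le dc inv (upd b e.2 j) eO ev.
    rewrite (negbTE pe) {2}/upd eqxx -/L => ly.
    rewrite (_ : PE * K * L * _ = p j * PE * (K * (L * (if (1 < j)%N then c else 1)))); last by ring.
    by apply: ler_wpM2l; [exact: mulr_ge0|exact: ler_wpM2l].
  apply: le_trans (lee_nneseries _ (fun j _ => Fle j)) _.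
    by move=> j _ _; apply: integral_ge0 => w _; rewrite lee_fin short_prob_ge0.
  rewrite nneseriesZl; last first.
    move=> j _; rewrite lee_fin mulr_ge0//; first by have [] := offp.
    by case: ifP.
  apply: (@le_trans _ _ ((PE * K * L)%:E * (p 1%N + (1 - p 1%N) * c)%:E)%E).
    apply: lee_wpmul2l; last exact: psi_series_le.
    by rewrite lee_fin; apply: mulr_ge0 => //; exact: mulr_ge0.
  by rewrite -EFinM lee_fin le_eqVlt /push_bound -/L; apply/orP; left; apply/eqP; ring.
rewrite (eq_integral (fun w => ((size O)%:R^-1)%:E *
    \sum_(k < size O) (v t (step_along x (nth (x, x) O k) s) w)%:E)%E); last first.
  move=> w; rewrite inE => Ew; rewrite /v /= -/X OE// szO sumEFin -EFinM.
  by rewrite /step_among; case: (O) sO.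
have v0 k w : (0 <= (v t (step_along x (nth (x, x) O k) s) w)%:E)%E.
  by rewrite lee_fin short_prob_ge0.
have O0 : 0 < (size O)%:R :> R by rewrite ltr0n.
rewrite ge0_integralZl_EFin//; last 2 first.
- by move=> w _; rewrite sume_ge0.
- by apply: emeasurable_sum => k; exact: (measurable_short_probE xi_law).
rewrite ge0_integral_sum//; last by move=> k; exact: (measurable_short_probE xi_law).
set PE := fine (P (E D b)).
have PE0 : 0 <= PE by rewrite fine_ge0.
rewrite fine_revealed -/PE.
apply: (@le_trans _ _ (((size O)%:R^-1)%:E * \sum_(k < size O) (PE * (K *
    step_cost (p 1%N + (1 - p 1%N) * c) lam c x s b (nth (x, x) O k)))%:E)%E).
  apply: lee_wpmul2l; first by rewrite lee_fin invr_ge0 ltW.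
  apply: lee_sum => k _; rewrite EFinM -fine_revealed.
  by apply: step; rewrite mem_nth.
rewrite sumEFin -!EFinM lee_fin -!mulr_sumr.
have := lyap_drift dc inv b0; rewrite -/X -/O (big_nth (x, x)) big_mkord => ld.
rewrite ler_pdivrMl// exprS -/K.
have := ler_wpM2l (mulr_ge0 PE0 K0) ld; rewrite -mulrA => /le_trans; apply.
rewrite le_eqVlt /K; apply/orP; left; apply/eqP; ring.
Qed.

End annealed_bound.

(** * Quenched estimates *)

(** Performs the earliest step first, from any time and state, whereas [lcrw] recurses on the last
    step; this allows induction on the number of remaining steps. *)
Fixpoint lcrw_run f x (c : nat -> nat -> nat) t r s : lcrw_state :=
  if r is r'.+1 then lcrw_run f x c t.+1 r' (lcrw_step f x (c t) s) else s.

Lemma lcrw_runS f x c t r s :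
  lcrw_run f x c t r.+1 s = lcrw_step f x (c (t + r)%N) (lcrw_run f x c t r s).
Proof.
elim: r t s => [|r IH] t s; first by rewrite addn0.
by rewrite -[LHS]/(lcrw_run f x c t.+1 r.+1 _) IH addSnnS.
Qed.

Lemma lcrw_runE f x c i : lcrw f x c i = lcrw_run f x c 0 i lcrw_init.
Proof. by elim: i => // i IH; rewrite lcrw_runS -IH. Qed.

Lemma take_lcrw_step f x ch s k : (k <= size s.2)%N ->
  (k <= size (lcrw_step f x ch s).2)%N ->
  take k (lcrw_step f x ch s).2 = take k s.2.
Proof.
rewrite lcrw_stepE /= /step_among; case: (out_edges _ _) => [//|e O] ks.
rewrite /step_along; case: ifP => _ /=.
  by move=> h; rewrite take_takel// (leq_trans h)// size_take_min geq_minl.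
by rewrite -cats1 takel_cat.
Qed.

(** A step only truncates the path or appends an edge, so the first [k] edges are frozen once the
    length stays above [k]. *)
Lemma converges_of_size f x c :
  (forall n, exists N, forall i, (N <= i)%N -> (n < size (lcrw f x c i).2)%N) ->
  converges_to_infinite_path (fun i => (lcrw f x c i).2).
Proof.
move=> h k; have [N hN] := h k; exists N => i Ni; split; first exact/ltnW/hN.
rewrite -(subnKC Ni); elim: (i - N)%N => [|m IH]; first by rewrite addn0.
rewrite addnS -IH [lcrw _ _ _ _.+1]/= take_lcrw_step//.
  by apply/ltnW/hN; rewrite leq_addr.
by apply/ltnW; apply: (hN (N + m).+1); rewrite leqW// leq_addr.
Qed.

(** * The walk on a fixed tree *)

Section quenched.
Variables (R : realType) (d : measure_display) (Omega : measurableType d).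
Variables (Q : probability Omega R) (c : nat -> nat -> Omega -> nat).
Hypothesis hc : choice_family Q c.
Variables (f : vertex -> nat) (x : vertex) (n : nat).

Definition short_run t r s : set Omega :=
  [set w | (size (lcrw_run f x (fun i k => c i k w) t r s).2 <= n)%N].

Lemma measurable_choice_preimage i k (B : set nat) : measurable (c i k @^-1` B).
Proof. by rewrite -[X in measurable X]setTI; case: hc => mc _ _; exact: mc. Qed.

(** The [k.+1] values up to [k], each of mass [1 / k.+1], already exhaust the probability. *)
Lemma choice_gt0 i k : Q (c i k @^-1` [set j | (k < j)%N]) = 0%E.
Proof.
have [_ hu _] := hc.
have mle : Q (c i k @^-1` [set j | (j <= k)%N]) = 1%E.
  rewrite (_ : _ @^-1` _ = \big[setU/set0]_(j < k.+1) (c i k @^-1` [set (j : nat)])).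
    rewrite measure_semi_additive_ord.
    - rewrite (eq_bigr (fun _ => (k.+1%:R^-1 : R)%:E)); last first.
        by move=> j _; apply: hu; rewrite -ltnS.
      by rewrite sumEFin sumr_const card_ord -(mulr_natr (k.+1%:R^-1)) mulVf.
    - by move=> j; exact: measurable_choice_preimage.
    - apply/trivIsetP => a b _ _ ab; apply/seteqP; split=> // w [/= wa wb].
      by move/eqP: ab; apply; apply/val_inj; rewrite /= -wa -wb.
    - by apply: bigsetU_measurable => j _; exact: measurable_choice_preimage.
  rewrite -(bigcup_mkord _ (fun j => c i k @^-1` [set j])); apply/seteqP; split=> w /=.
    by move=> wk; exists (c i k w) => //=; rewrite ltnS.
  by move=> [j /= jk ->]; rewrite -ltnS.
rewrite (_ : _ @^-1` _ = ~` (c i k @^-1` [set j | (j <= k)%N])).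
  by rewrite probability_setC ?mle ?subee//; exact: measurable_choice_preimage.
by apply/seteqP; split=> w /=; rewrite ltnNge => /negP.
Qed.

Lemma lcrw_run_cons t r s w : let O := out_edges f (top_block x s) in
  lcrw_run f x (fun i k => c i k w) t r.+1 s =
  lcrw_run f x (fun i k => c i k w) t.+1 r
    (step_among x O (c t (size O).-1 w) s).
Proof. by rewrite /= lcrw_stepE. Qed.

Lemma short_run0 t s :
  short_run t 0 s = if (size s.2 <= n)%N then setT else set0.
Proof. by case: ifP => h; apply/seteqP; split=> w; rewrite /short_run /= h. Qed.

Lemma measurable_short_run t r s : measurable (short_run t r s).
Proof.
elim: r t s => [|r IH] t s.
  by rewrite short_run0; case: ifP.
set O := out_edges f (top_block x s).
rewrite (_ : short_run _ _ _ = \bigcup_k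
  ((c t (size O).-1 @^-1` [set k]) `&` short_run t.+1 r (step_among x O k s))).
  apply: bigcupT_measurable => k; apply: measurableI => //.
  exact: measurable_choice_preimage.
apply/seteqP; split=> w; rewrite /short_run /mkset lcrw_run_cons -/O.
  by move=> h; exists (c t (size O).-1 w).
by move=> [k _ [/= ->]].
Qed.

Definition choice_cyl (l : seq (nat * nat)) (B : nat * nat -> set nat) : set Omega :=
  \big[setI/setT]_(ij <- l) (c ij.1 ij.2 @^-1` B ij).

(** Markov property in cylinder form: the indices in [l] have times before [t], so the choice at
    time [t] is independent of the cylinder. Fixing its value adds one index, and the induction
    resumes at time [t.+1]. *)
Lemma quenched_short_prob r t s l B : uniq l -> all (fun ij => (ij.1 < t)%N) l ->
  (Q (choice_cyl l B `&` short_run t r s) <=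
   Q (choice_cyl l B) * (short_prob R f x n r s)%:E)%E.
Proof.
have [_ hu ind] := hc.
have mcyl l' B' : measurable (choice_cyl l' B').
  by apply: bigsetI_measurable => ij _; exact: measurable_choice_preimage.
elim: r t s l B => [|r IH] t s l B ul lt.
  rewrite short_run0 /=; case: ifP => _; first by rewrite setIT mule1.
  by rewrite setI0 measure0 mule0.
set O := out_edges f (top_block x s); set N := (size O).-1.
set H := choice_cyl l B.
(* The piece of index [N.+1] is the null event that the choice exceeds [N]. *)
pose G k := if (k < N.+1)%N then H `&` (c t N @^-1` [set k]) `&`
   short_run t.+1 r (step_among x O k s) else c t N @^-1` [set j | (N < j)%N].
have tl : (t, N) \notin l.
  by apply/negP => /(allP lt) /=; rewrite ltnn.
have Hk k : H `&` (c t N @^-1` [set k]) =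
    choice_cyl ((t, N) :: l) (fun ij => if ij == (t, N) then [set k] else B ij).
  rewrite /choice_cyl big_cons eqxx setIC; congr (_ `&` _).
  apply: eq_big_seq => ij ijl; rewrite ifF//.
  by apply/negP => /eqP e; rewrite -e ijl in tl.
have QHk k : (k <= N)%N -> Q (H `&` (c t N @^-1` [set k])) = (Q H * (N.+1%:R^-1)%:E)%E.
  move=> kN; rewrite Hk /choice_cyl.
  rewrite (ind _ (fun ij => if ij == (t, N) then [set k] else B ij)); last first.
    by rewrite /= tl.
  rewrite big_cons eqxx hu// muleC; congr (_ * _)%E.
  rewrite /H /choice_cyl (ind _ B)//; apply: eq_big_seq => ij ijl; rewrite ifF//.
  by apply/negP => /eqP e; rewrite -e ijl in tl.
have mG k : measurable (G k).
  rewrite /G; case: ifP => _; last exact: measurable_choice_preimage.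
  apply: measurableI; last exact: measurable_short_run.
  by apply: measurableI; [exact: mcyl|exact: measurable_choice_preimage].
apply: (@le_trans _ _ (\sum_(k < N.+2) Q (G k))%E).
  apply: content_subadditive => //; first by apply: measurableI; [exact: mcyl|exact: measurable_short_run].
  move=> w [Hw]; rewrite /short_run /mkset lcrw_run_cons -/O -/N => h.
  rewrite -bigcup_mkord; case: (leqP (c t N w) N) => cN.
    by exists (c t N w); [rewrite /= !ltnS leqW|rewrite /G ltnS cN].
  by exists N.+1 => //=; rewrite /G ltnn.
rewrite big_ord_recr /= {2}/G ltnn choice_gt0 adde0.
apply: (@le_trans _ _ (\sum_(k < N.+1) (Q H * (N.+1%:R^-1)%:E *
    (short_prob R f x n r (step_among x O k s))%:E))%E).
  apply: lee_sum => k _; have kN : (k <= N)%N by rewrite -ltnS.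
  rewrite /G ltn_ord -(QHk _ kN) Hk; apply: IH.
    by rewrite /= tl.
  by rewrite /= ltnSn; apply: sub_all lt => ij /= /ltnW.
rewrite -/O -/N; have -> : Q H = (fine (Q H))%:E by rewrite fineK// fin_num_measure//; exact: mcyl.
rewrite -!EFinM (eq_bigr (fun k : 'I_N.+1 => (fine (Q H) * N.+1%:R^-1 *
  short_prob R f x n r (step_among x O k s))%:E)); last by move=> k _; rewrite !EFinM.
by rewrite sumEFin lee_fin -mulr_sumr mulrA.
Qed.

End quenched.

(** Borel-Cantelli for each [n]: almost surely the length is at most [n] only finitely often. *)
Lemma transient_of_summable (R : realType) f x :
  (forall n, \sum_(t <oo) (short_prob R f x n t lcrw_init)%:E < +oo)%E ->
  LCRW_transient R f x.
Proof.
move=> hs d Omega Q c hc.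
pose F n t := short_run c f x n 0 t lcrw_init.
have mF n t : measurable (F n t) by exact: measurable_short_run hc _ _ _ _ _ _.
have F0 n : Q (lim_sup_set (F n)) = 0%E.
  apply: lim_sup_set_cvg0 => //; apply: le_lt_trans (hs n).
  apply: lee_nneseries => // t _.
  have := quenched_short_prob hc f x n t lcrw_init (fun _ => setT) (isT : uniq [::]) (isT : all (fun ij => (ij.1 < 0)%N) [::]).
  by rewrite /choice_cyl big_nil setTI probability_setT mul1e.
have : {ae Q, forall w n, ~ lim_sup_set (F n) w}.
  apply: ae_foralln => n; exists (lim_sup_set (F n)); split; [|exact: F0|].
    apply: bigcapT_measurable => k; apply: bigcup_measurable => j _; exact: mF.
  by move=> w /= /contrapT.
apply: filterS => w hw; apply: converges_of_size => n.
have /existsNP[N hN] : ~ (forall N, (\bigcup_(j >= N) F n j) w).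
  by move=> h; apply: (hw n) => N _; exact: h.
exists N => i Ni; rewrite ltnNge; apply/negP => si; apply: hN.
by exists i => //; rewrite /F /short_run /mkset -lcrw_runE.
Qed.

(** * Transience *)

Lemma ae_forall_countable (T : countType) d (Omega : measurableType d)
    (R : realType) (mu : {measure set Omega -> \bar R}) (A : T -> Omega -> Prop) :
  (forall i, {ae mu, forall w, A i w}) -> {ae mu, forall w i, A i w}.
Proof.
move=> h; have : {ae mu, forall w k, if unpickle k is Some i then A i w else True}.
  apply: ae_foralln => k; case: (unpickle k) => [i|]; first exact: h.
  exact: aeW.
by apply: filterS => w hw i; have := hw (pickle i); rewrite pickleK.
Qed.

Lemma ge0_nneseries_geometric_lty (R : realType) (a z : R) : 0 <= a -> 0 < z -> z < 1 ->
  (\sum_(t <oo) (a * z ^+ t)%:E < +oo)%E.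
Proof.
move=> a0 z0 z1; apply: (@le_lt_trans _ _ (a / (1 - z))%:E); last exact: ltry.
apply: lime_le.
  by apply: is_cvg_nneseries => t _ _; rewrite lee_fin mulr_ge0// exprn_ge0// ltW.
apply: nearW => m; rewrite sumEFin lee_fin.
by apply: geometric_le_lim => //; rewrite ger0_norm// ltW.
Qed.

(** Otherwise all the mass sits at 1 and the mean equals 1. *)
Lemma offspring_one_lt1 (R : realType) (p : nat -> R) :
  offspring_law p -> p 0%N = 0 -> (1 < mean p)%E -> p 1%N < 1.
Proof.
move=> [pge0 p1] p0; apply: contraTT; rewrite -!leNgt => p1ge.
have partial m : \sum_(0 <= k < m) p k <= 1.
  by rewrite -lee_fin -p1 -sumEFin; apply: nneseries_lim_ge => k _; rewrite lee_fin.
have p1le : p 1%N <= 1.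
  by have := partial 2%N; rewrite !big_nat_recr//= big_geq// p0 !add0r.
have pj j : (1 < j)%N -> p j = 0.
  case: j => [|[|j]]// _; apply/le_anti; rewrite pge0 andbT.
  have := partial j.+3; rewrite big_nat_recr//= big_nat_recl// big_nat_recl//= p0 add0r.
  have : 0 <= \sum_(0 <= i < j) p i.+2 by apply: sumr_ge0.
  by move: p1ge; lra.
rewrite /mean (eq_eseriesr (g := fun k => (if k == 1%N then p 1%N else 0)%:E)); last first.
  by move=> [|[|k]] _ /=; rewrite ?mul0r ?mul1r// pj// mulr0.
by rewrite nneseries_single// lee_fin.
Qed.

Section annealed_transience.
Variables (R : realType) (d : measure_display) (Omega : measurableType d).
Variables (P : probability Omega R) (law : vertex -> nat -> R) (p : nat -> R).
Variable xi : vertex -> Omega -> nat.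
Hypothesis xi_law : indep_family_with_laws P law xi.
Hypothesis law_p : forall u, u != [::] -> law u = p.
Hypothesis law0 : forall u, law u 0%N = 0.
Hypothesis offp : offspring_law p.
Hypothesis p0 : p 0%N = 0.
Hypothesis mean_gt1 : (1 < mean p)%E.

Lemma ae_xi_gt0 : {ae P, forall w u, (0 < xi u w)%N}.
Proof.
apply: ae_forall_countable => u; exists (xi u @^-1` [set 0%N]); split.
- exact: (measurable_xi_preimage xi_law).
- by have [_ xp _] := xi_law; apply: (etrans (xp u 0%N)); rewrite law0.
- by move=> w /= /negP; rewrite lt0n negbK => /eqP.
Qed.

(** By Tonelli, the integral of the series over the event is at most a geometric series; an
    integrable function is finite almost everywhere. *)
Lemma ae_summable_revealed x n D b : uniq D -> D =i prefixes x ->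
  (forall u, (0 < b u)%N) ->
  {ae P, forall w, revealed xi D b w ->
    (\sum_(t <oo) (short_prob R (fun u => xi u w) x n t lcrw_init)%:E < +oo)%E}.
Proof.
move=> uD DE b0.
have [lam [c [rho dc]]] : exists lam c rho,
    drift_constants (p 1%N + (1 - p 1%N) * c) lam c rho.
  by apply: drift_constants_exist; [have [] := offp|exact: offspring_one_lt1].
have [lam0 c0 rho0] := And3 (dc_lam0 dc) (dc_c0 dc) (dc_rho0 dc).
set E := revealed xi D b.
have mE : measurable E by exact: measurable_revealed xi_law _ _.
set v := fun t w => (short_prob R (fun u => xi u w) x n t lcrw_init)%:E.
have v0 t w : (0 <= v t w)%E by rewrite lee_fin short_prob_ge0.
have mv t : measurable_fun E (v t) by exact: (measurable_short_probE xi_law).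
have DE' : D =i visited x lcrw_init ++ prefixes x.
  move=> u; rewrite DE [RHS](_ : _ = (u == x) || (u \in prefixes x))//.
  case: eqP => // ->.
  by rewrite mem_prefixes prefix_refl.
have iE : P.-integrable E (fun w => \sum_(t <oo) v t w)%E.
  apply/integrableP; split.
    exact: (@ge0_emeasurable_sum _ _ _ _ v predT).
  rewrite (eq_integral (fun w => \sum_(t <oo) v t w)%E); last first.
    by move=> w _; rewrite gee0_abs// nneseries_ge0.
  rewrite integral_nneseries//.
  set K := fine (P E) * ((lam ^+ n * c)^-1 * lyap lam c x b lcrw_init).
  have K0 : 0 <= K.
    apply: mulr_ge0; first exact: fine_ge0.
    by apply: mulr_ge0; [rewrite invr_ge0 mulr_ge0 ?exprn_ge0// ltW|exact: lyap_ge0 dc _ _].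
  apply: le_lt_trans (ge0_nneseries_geometric_lty K0 rho0 (dc_rho1 dc)).
  apply: lee_nneseries => [t _ _|t _]; first exact: integral_ge0.
  apply: le_trans (annealed_short_prob xi_law law_p offp p0 dc n t (walk_inv_init x) uD DE' b0) _.
  rewrite -/E (fine_revealed xi_law D b) -/E -EFinM lee_fin /K le_eqVlt.
  by apply/orP; left; apply/eqP; ring.
have := integrable_ae mE iE; apply: filterS => w + Ew => /(_ Ew).
by rewrite ge0_fin_numE// nneseries_ge0.
Qed.

(** For each [x], the events fixing the offspring numbers at its prefixes form a countable cover of
    the positive environments; letting [x] and [n] vary, only countably many null sets are
    excluded. *)
Theorem ae_transient :
  {ae P, forall w x, LCRW_transient R (fun u => xi u w) x}.
Proof.
(* The operation [.-1.+1] makes [b] positive everywhere and leaves positive entries unchanged. *)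
pose b x (l : seq nat) := fun u => (nth 0%N l (index u (prefixes x))).-1.+1.
have : {ae P, forall w (i : vertex * nat * seq nat),
    revealed xi (prefixes i.1.1) (b i.1.1 i.2) w ->
    (\sum_(t <oo) (short_prob R (fun u => xi u w) i.1.1 i.1.2 t lcrw_init)%:E < +oo)%E}.
  apply: ae_forall_countable => -[[x n] l]; exact: ae_summable_revealed (uniq_prefixes x) _ _.
have := ae_xi_gt0; apply: filterS2 => w xi0 hw x.
apply: transient_of_summable => n.
apply: (hw (x, n, [seq xi u w | u <- prefixes x])).
apply/revealedP => u ux.
rewrite -[RHS]/(b x [seq xi u w | u <- prefixes x] u) /b (nth_map u) ?index_mem// nth_index//.
by rewrite prednK.
Qed.

End annealed_transience.

(** * Transience on Galton-Watson and unimodular Galton-Watson trees *)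

Theorem mainTheorem5 (R : realType) (p : nat -> R) :
  offspring_law p -> p 0%N = 0 ->
  (1 < mean p)%E -> (mean p < +oo)%E ->
  (forall d (Omega : measurableType d) (P : probability Omega R)
          (xi : vertex -> Omega -> nat),
     GW_family P p xi ->
     {ae P, forall w, forall x, inT (fun u => xi u w) x ->
                      LCRW_transient R (fun u => xi u w) x})
  /\
  (forall d (Omega : measurableType d) (P Q : probability Omega R)
          (xi : vertex -> Omega -> nat),
     AGW_family P p xi -> UGW_bias P Q xi ->
     {ae Q, forall w, forall x, inT (fun u => xi u w) x ->
                      LCRW_transient R (fun u => xi u w) x}).
Proof.
move=> offp p0 mean1 _; split=> [d Omega P xi hxi|d Omega P Q xi hxi bias].
  have := ae_transient hxi (fun _ _ => erefl) (fun _ => p0) offp p0 mean1.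
  by apply: filterS => w hw x _.
(* Only the root has a law other than [p]; being a prefix of every [x], it is revealed from the
   start. *)
pose law (u : vertex) := if u is [::] then shift_law p else p.
have law_p u : u != [::] -> law u = p by case: u.
have law0 u : law u 0%N = 0 by case: u.
have xi0 := ae_xi_gt0 hxi law0.
have [N [mN PN0 sN]] := ae_transient hxi law_p law0 offp p0 mean1.
exists N; split=> //; last first.
  by move=> w nw; apply: sN => hw; apply: nw => x _; exact: hw.
have mdeg : measurable_fun setT (fun w => ((xi [::] w)%:R^-1 : R)%:E).
  apply/measurable_EFinP.
  apply: (@measurable_fun_countable_case _ _ _ _ (xi [::]) (fun k _ => k%:R^-1)) => // k.
  exact: measurable_xi_preimage hxi _ _.
(* Absolute continuity of [Q]: [1 / deg] integrates to zero over the [P]-null set [N], so [Q N]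
   times the normalizing constant is zero. *)
have := bias N mN; rewrite [RHS](null_set_integral mN)//; last exact: measurable_funTS.
move=> /eqP; rewrite mule_eq0 => /orP[/eqP//|/eqP int0].
(* A zero normalizing constant would force [1 / deg] to vanish almost everywhere, although the root
   degree is almost surely positive. *)
exfalso; have : ae_eq P setT (fun w => ((xi [::] w)%:R^-1 : R)%:E) (cst 0%E).
  apply/(ae_eq_integral_abs P measurableT mdeg); rewrite -[RHS]int0.
  by apply: eq_integral => w _; rewrite gee0_abs// lee_fin invr_ge0.
move=> ae0; have : {ae P, forall w, False}.
  move: xi0 ae0; apply: filterS2 => w /(_ [::]) w0 /(_ I) [] /eqP.
  by rewrite invr_eq0 pnatr_eq0 eqn0Ngt w0.
case=> A [mA A0 /(_ _ _) sA]; have : P setT = 0%E.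
  by rewrite -A0; congr (P _); apply/seteqP; split=> w // _; exact: sA.
by rewrite probability_setT => /eqP; rewrite onee_eq0.
Qed.
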